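(* The category $\mathcal Perm$ is symmetric monoidal with braiding isomorphisms $M^{k,l}\to M^{l,k}$ ($k,l\ge0$) given by $$\sum_{a,b\ge0,\ a-b=k-l}(-1)^{k-a}\,E^{(b)}_{k-a,\,l+a}F^{(a)}_{k,l}\;=\;\sum_{a,b\ge0,\ a-b=l-k}(-1)^{l-a}\,F^{(b)}_{k+a,\,l-a}E^{(a)}_{k,l}$$ (in particular the two sums are equal).
   Context: For a composition $\lambda=(\lambda_1,\dots,\lambda_n)$ of $d\in\mathbb N$ (written $\lambda\vDash d$), $S_\lambda\le S_d$ is the Young subgroup $S_{\{1,\dots,\lambda_1\}}\times S_{\{\lambda_1+1,\dots,\lambda_1+\lambda_2\}}\times\cdots$, and $M^\lambda=M^\lambda_d:=\mathbb C[S_\lambda\backslash S_d]$ is the right permutation $\mathbb C[S_d]$-module. $\mathcal Perm$ has objects $M^\lambda_d$ for all $d\in\mathbb N$, $\lambda\vDash d$; $\operatorname{Hom}(M^\lambda_d,M^\mu_{d'})=\operatorname{Hom}_{S_d}(M^\lambda_d,M^\mu_d)$ if $d=d'$ and $0$ otherwise. It is monoidal via $X\circ Y=\operatorname{Ind}_{S_d\times S_{d'}}^{S_{d+d'}}(X\boxtimes Y)$, for which $M^\lambda_d\circ M^\mu_{d'}=M^{(\lambda,\mu)}_{d+d'}$, $(\lambda,\mu)$ being the concatenation; so $M^{k,l}=M^k\circ M^l$, and the braiding on general objects is determined from that on the one-part objects $M^k$ by the hexagon axioms. Zero entries of a sequence may be deleted. For $k,l\ge0$: $\nabla_{k,l}:M^{k,l}\to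 M^{k+l}=\mathbb C$, $\sum_g c_g\,S_{k,l}g\mapsto\sum_g c_g$ (sum over right cosets), and $\Delta_{k,l}:M^{k+l}=\mathbb C\to M^{k,l}$, $1\mapsto\frac1{k!\,l!}\sum_{g\in S_{k+l}}S_{k,l}g$. Put $F^{(a)}_{k,l}=(1_{M^{k-a}}\circ\nabla_{a,l})(\Delta_{k-a,a}\circ1_{M^l}):M^{k,l}\to M^{k-a,l+a}$ and $E^{(b)}_{k,l}=(\nabla_{k,b}\circ1_{M^{l-b}})(1_{M^k}\circ\Delta_{b,l-b}):M^{k,l}\to M^{k+b,l-b}$, where a morphism is $0$ whenever a negative index occurs. *)

(* Defs.v *)
From HB Require Import structures.
From mathcomp Require Import all_boot all_order all_fingroup all_algebra.
Set Implicit Arguments.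
Unset Strict Implicit.
Unset Printing Implicit Defensive.
Import GRing.Theory.
Local Open Scope ring_scope.

Record monoidal_data := MonoidalData {
  obj :> Type;
  mor : obj -> obj -> Type;
  idmor : forall X, mor X X;
  cmp : forall X Y Z, mor Y Z -> mor X Y -> mor X Z;
  unit_obj : obj;
  tens : obj -> obj -> obj;
  tensm : forall X X' Y Y',
    mor X X' -> mor Y Y' -> mor (tens X Y) (tens X' Y');
  assoc : forall X Y Z, mor (tens (tens X Y) Z) (tens X (tens Y Z));
  assocV : forall X Y Z, mor (tens X (tens Y Z)) (tens (tens X Y) Z);
  lunit : forall X, mor (tens unit_obj X) X;
  runit : forall X, mor (tens X unit_obj) X }.

Arguments idmor {m} X.
Arguments cmp {m X Y Z}.
Arguments unit_obj {m}.
Arguments tens {m}.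
Arguments tensm {m X X' Y Y'}.
Arguments assoc {m}.
Arguments assocV {m}.
Arguments lunit {m}.
Arguments runit {m}.

Declare Scope moncat_scope.
Delimit Scope moncat_scope with MC.
Notation "g ⋅ f" := (cmp g f) (at level 40, left associativity) : moncat_scope.
Notation "X ⊗ Y" := (tens X Y) (at level 38, left associativity) : moncat_scope.
Notation "f ⊠ g" := (tensm f g) (at level 38, left associativity) : moncat_scope.
Local Open Scope moncat_scope.

Definition is_iso (C : monoidal_data) (X Y : C) (f : mor X Y) : Prop :=
  exists g : mor Y X, g ⋅ f = idmor X /\ f ⋅ g = idmor Y.

Record is_category (C : monoidal_data) : Prop := IsCategory {
  cmp_idl : forall (X Y : C) (f : mor X Y), idmor Y ⋅ f = f;
  cmp_idr : forall (X Y : C) (f : mor X Y), f ⋅ idmor X = f;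
  cmp_assoc : forall (X Y Z W : C) (h : mor Z W) (g : mor Y Z) (f : mor X Y),
    h ⋅ (g ⋅ f) = h ⋅ g ⋅ f }.

Record is_monoidal (C : monoidal_data) : Prop := IsMonoidal {
  monoidal_category : is_category C;
  tensm_id : forall X Y : C, idmor X ⊠ idmor Y = idmor (X ⊗ Y);
  tensm_cmp : forall (X X' X'' Y Y' Y'' : C)
      (f : mor X X') (f' : mor X' X'') (g : mor Y Y') (g' : mor Y' Y''),
    (f' ⋅ f) ⊠ (g' ⋅ g) = (f' ⊠ g') ⋅ (f ⊠ g);
  assocK : forall X Y Z : C, assocV X Y Z ⋅ assoc X Y Z = idmor _;
  assocVK : forall X Y Z : C, assoc X Y Z ⋅ assocV X Y Z = idmor _;
  lunit_iso : forall X : C, is_iso (lunit X);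
  runit_iso : forall X : C, is_iso (runit X);
  assoc_natural : forall (X X' Y Y' Z Z' : C)
      (f : mor X X') (g : mor Y Y') (h : mor Z Z'),
    assoc X' Y' Z' ⋅ (f ⊠ g ⊠ h) = (f ⊠ (g ⊠ h)) ⋅ assoc X Y Z;
  lunit_natural : forall (X Y : C) (f : mor X Y),
    lunit Y ⋅ (idmor unit_obj ⊠ f) = f ⋅ lunit X;
  runit_natural : forall (X Y : C) (f : mor X Y),
    runit Y ⋅ (f ⊠ idmor unit_obj) = f ⋅ runit X;
  pentagon : forall X Y Z W : C,
    assoc X Y (Z ⊗ W) ⋅ assoc (X ⊗ Y) Z W =
    (idmor X ⊠ assoc Y Z W) ⋅ assoc X (Y ⊗ Z) W ⋅ (assoc X Y Z ⊠ idmor W);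
  triangle : forall X Y : C,
    (idmor X ⊠ lunit Y) ⋅ assoc X unit_obj Y = runit X ⊠ idmor Y }.

Record is_symmetric_braiding (C : monoidal_data)
    (beta : forall X Y : C, mor (X ⊗ Y) (Y ⊗ X)) : Prop := IsSymmetricBraiding {
  braiding_iso : forall X Y : C, is_iso (beta X Y);
  braiding_natural : forall (X X' Y Y' : C) (f : mor X X') (g : mor Y Y'),
    beta X' Y' ⋅ (f ⊠ g) = (g ⊠ f) ⋅ beta X Y;
  hexagon1 : forall X Y Z : C,
    assoc Y Z X ⋅ beta X (Y ⊗ Z) ⋅ assoc X Y Z =
    (idmor Y ⊠ beta X Z) ⋅ assoc Y X Z ⋅ (beta X Y ⊠ idmor Z);
  hexagon2 : forall X Y Z : C,
    assocV Z X Y ⋅ beta (X ⊗ Y) Z ⋅ assocV X Y Z =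
    (beta X Z ⊠ idmor Y) ⋅ assocV X Z Y ⋅ (idmor X ⊠ beta Y Z);
  braiding_symmetric : forall X Y : C, beta Y X ⋅ beta X Y = idmor (X ⊗ Y) }.

Definition block d (lam : seq nat) (j : nat) : {set 'I_d} :=
  [set i : 'I_d | sumn (take j lam) <= i < sumn (take j.+1 lam)]%N.

Definition young d (lam : seq nat) : {set 'S_d} :=
  (\prod_(j < size lam) Sym (block d lam j))%g.

Lemma mem_prod_Sym (T : finType) (I : eqType) (r : seq I) (P : I -> {set T})
    (g : {perm T}) :
  (forall x, x \notin \bigcup_(j <- r) P j -> g x = x) ->
  (forall j, {in P j, forall x, g x \in P j}) ->
  g \in (\prod_(j <- r) Sym (P j))%g.
Proof.
elim: r g => [|j r IHr] g gout gP.
  rewrite big_nil inE; apply/eqP/permP => x; rewrite perm1 gout //.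
  by rewrite big_nil inE.
have gN k : g \in ('N(P k | 'P))%g by rewrite !inE; apply/subsetP => x /gP; rewrite inE.
set h := restr_perm (P j) g.
have hP : perm_on (P j) h by exact: restr_perm_on.
rewrite big_cons; apply/mulsgP.
have hE x : x \in P j -> h x = g x by move=> xj; rewrite restr_permE.
have hO x : x \notin P j -> h x = x by move=> xj; rewrite (out_perm hP).
have kE x : x \in P j -> (h^-1 * g)%g x = x.
  move=> xj; rewrite permM.
  have yj : h^-1%g x \in P j by rewrite -(perm_closed _ hP) permKV.
  by rewrite -(hE _ yj) permKV.
have kO x : x \notin P j -> (h^-1 * g)%g x = g x.
  by move=> xj; rewrite permM -{1}(hO _ xj) permK.
exists h (h^-1 * g)%g; [by rewrite inE| | by rewrite mulKVg].
apply: IHr => [x xr|k x xk]; have [xj|xj] := boolP (x \in P j).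
- exact: kE.
- by rewrite kO // gout // big_cons inE negb_or xj.
- by rewrite kE.
- by rewrite kO // gP.
Qed.

Lemma sumn_take_le (lam : seq nat) j k :
  (j <= k)%N -> (sumn (take j lam) <= sumn (take k lam))%N.
Proof.
move=> le_jk; rewrite -(cat_take_drop j (take k lam)) take_takel // sumn_cat.
exact: leq_addr.
Qed.

Lemma ltn_sumn_take (lam : seq nat) j i : (i < sumn (take j lam))%N ->
  exists2 k, (k < minn j (size lam))%N &
    (sumn (take k lam) <= i < sumn (take k.+1 lam))%N.
Proof.
elim: j => [|j IHj]; first by rewrite take0.
have [le|lt] := leqP (sumn (take j lam)) i => [ij|_].
  have jl : (j < size lam)%N.
    rewrite ltnNge; apply/negP => lj; move: ij le.
    by rewrite !take_oversize ?(leq_trans lj) // => /leq_trans h /h; rewrite ltnn.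
  by exists j; rewrite ?le // leq_min ltnS leqnn.
have [k kj ik] := IHj lt; exists k => //; apply: leq_trans kj _.
by rewrite leq_min geq_minr andbT (leq_trans (geq_minl _ _)).
Qed.

(* [young d lam] consists of the permutations stabilising every initial segment
   [{i | i < lam_1 + ... + lam_j}], equivalently every block. *)
Lemma mem_youngP d (lam : seq nat) (g : 'S_d) : sumn lam = d ->
  reflect (forall j i, (g i < sumn (take j lam))%N = (i < sumn (take j lam))%N)
          (g \in young d lam).
Proof.
move=> lamd; apply: (iffP idP) => [|gP].
  rewrite /young; elim/big_rec: _ g => [g /set1P-> j i|k A _ IHA g /mulsgP[s t]].
    by rewrite perm1.
  rewrite inE => son /IHA tP -> j i; rewrite permM tP.
  have [ik|ik] := boolP (i \in block d lam k); last by rewrite (out_perm son).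
  have := ik; rewrite -(perm_closed _ son) !inE => /andP[a b].
  move: ik; rewrite inE => /andP[a' b'].
  have [jk|kj] := leqP j k.
    have le := sumn_take_le lam jk.
    by rewrite !ltnNge (leq_trans le a) (leq_trans le a').
  have le := sumn_take_le lam kj.
  by rewrite (leq_trans b' le) (leq_trans b le).
rewrite /young; apply: (@mem_prod_Sym _ _ _ (fun j : 'I_(size lam) => block d lam j))
  => [x|j x]; last by rewrite !inE !(leqNgt (sumn _)) !gP.
apply: contraNeq => _; have : (x < sumn (take (size lam) lam))%N by rewrite take_size lamd.
case/ltn_sumn_take => k; rewrite minnn => kl xk.
by apply/bigcupP; exists (Ordinal kl); rewrite ?inE.
Qed.

Lemma young_group_set d (lam : seq nat) : sumn lam = d ->
  group_set (young d lam).
Proof.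
move=> lamd; apply/group_setP; split=> [|s t].
  by apply/mem_youngP => // j i; rewrite perm1.
move=> /(mem_youngP _ lamd) sP /(mem_youngP _ lamd) tP.
by apply/mem_youngP => // j i; rewrite permM tP sP.
Qed.

Lemma sumn_take_cat (lam mu : seq nat) j :
  sumn (take j (lam ++ mu)) =
  (sumn (take j lam) + sumn (take (j - size lam) mu))%N.
Proof.
rewrite take_cat; case: ltnP => [lt|le].
  by rewrite (eqP (ltnW lt)) take0 addn0.
by rewrite sumn_cat (take_oversize le).
Qed.

(* Zero parts may be deleted without changing the Young subgroup, hence without
   changing the permutation module. *)
Lemma young_del0 d (lam mu : seq nat) : sumn (lam ++ mu) = d ->
  young d (lam ++ 0%N :: mu) = young d (lam ++ mu).
Proof.
move=> lmd; have lmd0 : sumn (lam ++ 0%N :: mu) = d by rewrite -lmd !sumn_cat.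
apply/setP => g; apply/(mem_youngP _ lmd0)/(mem_youngP _ lmd) => gP j i.
  have [le|lt] := leqP j (size lam).
    by have := gP j i; rewrite !sumn_take_cat (eqP le) !take0.
  by have := gP j.+1 i; rewrite !sumn_take_cat subSn ?(ltnW lt) //=
    (take_oversize (leqW (ltnW lt))) (take_oversize (ltnW lt)).
have [le|lt] := leqP j (size lam).
  by have := gP j i; rewrite !sumn_take_cat (eqP le) !take0.
have := gP j.-1 i; rewrite !sumn_take_cat; case: j lt => // j /=; rewrite ltnS => le.
by rewrite subSn //= (take_oversize le) (take_oversize (leqW le)).
Qed.

Definition ycoset d (lam : seq nat) : finType :=
  {A : {set 'S_d} | A \in rcosets (young d lam) [set: 'S_d]}.

Lemma mkcoset_subproof d lam (g : 'S_d) :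
  (young d lam :* g)%g \in rcosets (young d lam) [set: 'S_d].
Proof. by apply/rcosetsP; exists g; rewrite ?inE. Qed.

Definition mkcoset d lam (g : 'S_d) : ycoset d lam :=
  exist _ (young d lam :* g)%g (mkcoset_subproof lam g).

Lemma coset_act_subproof d lam (A : ycoset d lam) (g : 'S_d) :
  (val A :* g)%g \in rcosets (young d lam) [set: 'S_d].
Proof.
by case/rcosetsP: (valP A) => h _ ->; rewrite -rcosetM mkcoset_subproof.
Qed.

Definition coset_act d lam (A : ycoset d lam) (g : 'S_d) : ycoset d lam :=
  exist _ (val A :* g)%g (coset_act_subproof A g).

Implicit Type F : fieldType.

Notation permmod F d lam := {ffun ycoset d lam -> F^o}.

HB.lock Definition bvec (F : fieldType) (I : finType) (i : I) :
  {ffun I -> F^o} := [ffun j => (j == i)%:R].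

Lemma bvecE F (I : finType) (i j : I) : bvec F i j = (j == i)%:R.
Proof. by rewrite unlock ffunE. Qed.

Definition linext F (I : finType) (V : vectType F)
    (phi : I -> V) : 'Hom({ffun I -> F^o}, V) :=
  linfun (fun v : {ffun I -> F^o} => \sum_i v i *: phi i).

Lemma linextE F (I : finType) (V : vectType F) (phi : I -> V) v :
  linext phi v = \sum_i v i *: phi i.
Proof.
pose f (v : {ffun I -> F^o}) := \sum_i v i *: phi i.
have fL : linear f.
  move=> a u w; rewrite /f scaler_sumr -big_split; apply: eq_bigr => i _ /=.
  by rewrite !ffunE scalerDl scalerA.
pose fLin := GRing.isLinear.Build _ _ _ _ f fL.
pose g : {linear _ -> _} := HB.pack f fLin.
exact: (lfunE g).
Qed.

Lemma linext_bvec F (I : finType) (V : vectType F)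
  (phi : I -> V) i : linext phi (bvec F i) = phi i.
Proof.
rewrite linextE (bigD1 i) //= bvecE eqxx scale1r big1 ?addr0 // => j /negPf ji.
by rewrite bvecE ji scale0r.
Qed.

Lemma ffun_bvec F (I : finType) (v : {ffun I -> F^o}) :
  v = \sum_i v i *: bvec F i.
Proof.
apply/ffunP => j; rewrite sum_ffunE (bigD1 j) //= big1 => [|i /negPf ij].
  by rewrite !(ffunE, bvecE F) eqxx addr0 /GRing.scale /= mulr1.
by rewrite !(ffunE, bvecE F) eq_sym ij /GRing.scale /= mulr0.
Qed.

Lemma eq_lfun_bvec F (I : finType) (V : vectType F)
    (f g : 'Hom({ffun I -> F^o}, V)) :
  (forall i, f (bvec F i) = g (bvec F i)) -> f = g.
Proof.
move=> fg; apply/lfunP => v; rewrite [v]ffun_bvec !linear_sum /=.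
by apply: eq_bigr => i _; rewrite !linearZ /= fg.
Qed.

Lemma lfun_bvec F (I : finType) (V : vectType F)
    (f : 'Hom({ffun I -> F^o}, V)) v :
  f v = \sum_i v i *: f (bvec F i).
Proof.
by rewrite {1}[v]ffun_bvec linear_sum; apply: eq_bigr => i _; rewrite linearZ.
Qed.

(* The right action of [g]. *)
Definition permact F d lam (g : 'S_d) : 'End(permmod F d lam) :=
  linext (fun A => bvec F (coset_act A g)).

Lemma permact_bvec F d lam (g : 'S_d) A :
  permact F lam g (bvec F A) = bvec F (coset_act A g).
Proof. exact: linext_bvec. Qed.

Lemma permactM F d lam (g h : 'S_d) v :
  @permact F d lam (g * h)%g v = permact F lam h (permact F lam g v).
Proof.
suff -> : permact F lam (g * h)%g = (permact F lam h \o permact F lam g)%VF.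
  by rewrite comp_lfunE.
apply: (@eq_lfun_bvec F (ycoset d lam)) => A.
rewrite comp_lfunE.
rewrite !permact_bvec.
congr (bvec _ _).
apply: val_inj => /=.
by rewrite rcosetM.
Qed.

Lemma coset_act_mkcoset d lam (s g : 'S_d) :
  coset_act (mkcoset lam s) g = mkcoset lam (s * g).
Proof. by apply: val_inj; rewrite /= rcosetM. Qed.

Lemma mkcoset_young d lam (s g : 'S_d) : sumn lam = d -> s \in young d lam ->
  mkcoset lam (s * g) = mkcoset lam g.
Proof.
move=> lamd ys; apply: val_inj => /=; rewrite rcosetM.
by rewrite -[young d lam]/(gval (Group (young_group_set lamd))) rcoset_id.
Qed.

Lemma repr_mkcoset d lam (A : ycoset d lam) : sumn lam = d ->
  A = mkcoset lam (repr (val A)).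
Proof.
move=> lamd; apply: val_inj => /=; case/rcosetsP: (valP A) => g _ /= ->.
by rewrite -[young d lam]/(gval (Group (young_group_set lamd))) rcoset_repr.
Qed.

Lemma repr_mkcosetP d lam (g : 'S_d) : sumn lam = d ->
  exists2 s, s \in young d lam & repr (val (mkcoset lam g)) = (s * g)%g.
Proof.
move=> lamd; rewrite /= -[young d lam]/(gval (Group (young_group_set lamd))).
by case: repr_rcosetP => s ys; exists s.
Qed.

Definition perm_sum_fun m n (s : 'S_m) (t : 'S_n) (i : 'I_(m + n)) :
    'I_(m + n) :=
  match split i with inl j => lshift n (s j) | inr j => rshift m (t j) end.

Lemma perm_sum_inj m n (s : 'S_m) (t : 'S_n) : injective (perm_sum_fun s t).
Proof.
move=> i j; rewrite /perm_sum_fun.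
case: (split_ordP i) => i' ->; case: (split_ordP j) => j' -> /eqP;
  rewrite ?eq_lshift ?eq_rshift ?eq_lrshift ?eq_rlshift // => /eqP.
  by move/perm_inj ->.
by move/perm_inj ->.
Qed.

Definition perm_sum m n (s : 'S_m) (t : 'S_n) : 'S_(m + n) :=
  perm (@perm_sum_inj m n s t).

Lemma perm_sum_lshift m n (s : 'S_m) (t : 'S_n) i :
  perm_sum s t (lshift n i) = lshift n (s i).
Proof.
rewrite permE /perm_sum_fun; case: split_ordP => j /eqP.
  by rewrite eq_lshift => /eqP->.
by rewrite eq_lrshift.
Qed.

Lemma perm_sum_rshift m n (s : 'S_m) (t : 'S_n) i :
  perm_sum s t (rshift m i) = rshift m (t i).
Proof.
rewrite permE /perm_sum_fun; case: split_ordP => j /eqP.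
  by rewrite eq_rlshift.
by rewrite eq_rshift => /eqP->.
Qed.

Lemma perm_sumM m n (s s' : 'S_m) (t t' : 'S_n) :
  perm_sum (s * s') (t * t') = (perm_sum s t * perm_sum s' t')%g.
Proof.
apply/permP => i; rewrite permM; case: (split_ordP i) => j ->.
  by rewrite !perm_sum_lshift permM.
by rewrite !perm_sum_rshift permM.
Qed.

(* [S_(lam, mu) = S_lam x S_mu]. *)
Lemma young_cat m n (lam mu : seq nat) (s : 'S_m) (t : 'S_n) :
  sumn lam = m -> sumn mu = n ->
  (perm_sum s t \in young (m + n) (lam ++ mu)) =
  (s \in young m lam) && (t \in young n mu).
Proof.
move=> lamm mun; have lmd : sumn (lam ++ mu) = (m + n)%N by rewrite sumn_cat lamm mun.
apply/(mem_youngP _ lmd)/andP => [stP|[/(mem_youngP _ lamm) sP /(mem_youngP _ mun) tP]].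
  split; apply/mem_youngP => // j i.
    have [le|/ltnW lt] := leqP j (size lam); last first.
      by rewrite take_oversize // lamm !ltn_ord.
    have := stP j (lshift n i); rewrite perm_sum_lshift /= sumn_take_cat.
    by rewrite (eqP le) take0 addn0.
  have := stP (size lam + j)%N (rshift m i); rewrite perm_sum_rshift /= sumn_take_cat.
  by rewrite addKn take_oversize ?leq_addr // lamm !ltn_add2l.
move=> j i; rewrite sumn_take_cat.
have le_m : (sumn (take j lam) <= m)%N.
  by rewrite -[leqRHS]lamm -{2}(take_size lam) -{1}(take_size lam) -take_min
    sumn_take_le // geq_minr.
have [le|/ltnW lt] := leqP j (size lam).
  rewrite (eqP le) take0 addn0; case: (split_ordP i) => k ->.
    by rewrite perm_sum_lshift /= sP.
  by rewrite perm_sum_rshift /= !ltnNge !(leq_trans le_m (leq_addr _ _)).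
rewrite take_oversize // lamm; case: (split_ordP i) => k ->.
  by rewrite perm_sum_lshift /= !(leq_trans (ltn_ord _) (leq_addr _ _)).
by rewrite perm_sum_rshift /= !ltn_add2l tP.
Qed.

Lemma young_cat_split m n (lam mu : seq nat) (g : 'S_(m + n)) :
  sumn lam = m -> sumn mu = n -> g \in young (m + n) (lam ++ mu) ->
  exists s t, [/\ s \in young m lam, t \in young n mu & g = perm_sum s t].
Proof.
move=> lamm mun gY.
have lmd : sumn (lam ++ mu) = (m + n)%N by rewrite sumn_cat lamm mun.
have gm i : (g i < m)%N = (i < m)%N.
  have /mem_youngP := gY => /(_ lmd (size lam) i).
  by rewrite sumn_take_cat subnn take0 addn0 take_size lamm.
have sK i : {k | g (lshift n i) = lshift n k}.
  have lt : (g (lshift n i) < m)%N by rewrite gm /=.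
  by exists (Ordinal lt); apply: val_inj.
have tK i : {k | g (rshift m i) = rshift m k}.
  have : ~~ (g (rshift m i) < m)%N by rewrite gm /= -leqNgt leq_addr.
  by case: (split_ordP (g (rshift m i))) => k -> // _; exists k.
have s_inj : injective (fun i => sval (sK i)).
  move=> i j; case: (sK i) (sK j) => k ki [l lj] /= kl.
  by apply: (@lshift_inj m n); apply: (@perm_inj _ g); rewrite ki lj kl.
have t_inj : injective (fun i => sval (tK i)).
  move=> i j; case: (tK i) (tK j) => k ki [l lj] /= kl.
  by apply: (@rshift_inj m n); apply: (@perm_inj _ g); rewrite ki lj kl.
have gE : g = perm_sum (perm s_inj) (perm t_inj).
  apply/permP => i; case: (split_ordP i) => k ->.
    by rewrite perm_sum_lshift permE; case: (sK k).
  by rewrite perm_sum_rshift permE; case: (tK k).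
exists (perm s_inj), (perm t_inj).
have : perm_sum (perm s_inj) (perm t_inj) \in young (m + n) (lam ++ mu).
  by rewrite -gE.
by rewrite young_cat // => /andP[].
Qed.

Definition composition : Type := {p : nat * seq nat | sumn p.2 == p.1}.

Definition wt (X : composition) : nat := (val X).1.
Definition parts (X : composition) : seq nat := (val X).2.

Lemma sumn_parts X : sumn (parts X) = wt X.
Proof. exact: (eqP (valP X)). Qed.

Definition equivariant F (X Y : composition) :
    {pred 'Hom(permmod F (wt X) (parts X), permmod F (wt Y) (parts Y))} :=
  fun f => match wt X =P wt Y with
  | ReflectT e => [forall g : 'S_(wt X),
      (f \o permact F (parts X) g == permact F (parts Y) (cast_perm e g) \o f)%VF]
  | ReflectF _ => f == 0
  end.
Arguments equivariant F X Y : clear implicits.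

Record perm_hom F (X Y : composition) := PermHom {
  perm_hom_val :> 'Hom(permmod F (wt X) (parts X), permmod F (wt Y) (parts Y));
  perm_homP : perm_hom_val \in equivariant F X Y }.

HB.instance Definition _ F X Y := [isSub for @perm_hom_val F X Y].
HB.instance Definition _ F X Y := [Choice of perm_hom F X Y by <:].

Lemma equivariantP F X Y (f : 'Hom(permmod F _ _, permmod F _ _)) :
  reflect (match wt X =P wt Y with
    | ReflectT e => forall g : 'S_(wt X),
      (f \o permact F (parts X) g = permact F (parts Y) (cast_perm e g) \o f)%VF
    | ReflectF _ => f = 0 end)
  (f \in equivariant F X Y).
Proof.
rewrite /equivariant /in_mem /=; case: eqP => [e|_]; last exact: eqP.
by apply: (iffP forallP) => fP g; apply/eqP/fP.
Qed.

Lemma equivariant_submod F X Y : submod_closed (equivariant F X Y).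
Proof.
split=> [|a f h /equivariantP fP /equivariantP hP]; apply/equivariantP.
  by case: eqP => // e g; rewrite comp_lfun0l comp_lfun0r.
case: eqP fP hP => [e fP hP g|_ -> ->]; last by rewrite scaler0 addr0.
by rewrite comp_lfunDl comp_lfunDr -comp_lfunZl -comp_lfunZr fP hP.
Qed.

HB.instance Definition _ F X Y :=
  GRing.isSubmodClosed.Build F _ (equivariant F X Y) (equivariant_submod F X Y).
HB.instance Definition _ F X Y :=
  [SubChoice_isSubLmodule of perm_hom F X Y by <:].

Lemma perm_id_subproof F X : \1%VF \in equivariant F X X.
Proof.
apply/equivariantP; case: eqP => // e g.
by rewrite comp_lfun1l comp_lfun1r cast_perm_id.
Qed.

Definition perm_id F X : perm_hom F X X := PermHom (perm_id_subproof F X).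

Lemma perm_cmp_subproof F X Y Z (g : perm_hom F Y Z) (f : perm_hom F X Y) :
  (g \o f)%VF \in equivariant F X Z.
Proof.
case: f g => [f /equivariantP fP] [g /equivariantP gP] /=.
apply/equivariantP; case: eqP fP => [eXY|nXY] fP; case: eqP gP => [eYZ|nYZ] gP.
- case: eqP => [eXZ|[]] => [h|]; last by rewrite eXY.
  rewrite -comp_lfunA fP !comp_lfunA gP cast_perm_comp.
  by rewrite (eq_irrelevance (etrans eXY eYZ) eXZ).
- case: eqP => [e|_]; first by case: nYZ; rewrite -eXY.
  by rewrite gP comp_lfun0l.
- case: eqP => [e|_]; first by case: nXY; rewrite eYZ.
  by rewrite fP comp_lfun0r.
rewrite fP comp_lfun0r; case: eqP => // e h.
by rewrite comp_lfun0l comp_lfun0r.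
Qed.

Definition perm_cmp F X Y Z (g : perm_hom F Y Z) (f : perm_hom F X Y) :
  perm_hom F X Z := PermHom (perm_cmp_subproof g f).

Definition perm_cast F X Y (e : X = Y) : perm_hom F X Y :=
  ecast Z (perm_hom F X Z) e (perm_id F X).

Lemma concat_subproof (X Y : composition) :
  sumn (parts X ++ parts Y) == (wt X + wt Y)%N.
Proof. by rewrite sumn_cat !sumn_parts. Qed.

Definition concat (X Y : composition) : composition :=
  exist _ ((wt X + wt Y)%N, parts X ++ parts Y) (concat_subproof X Y).

Definition empty_comp : composition := exist _ (0%N, [::]) (eqxx 0%N).

Lemma concatA X Y Z : concat (concat X Y) Z = concat X (concat Y Z).
Proof. by apply: val_inj; rewrite /= /wt /parts /= addnA catA. Qed.

Lemma concat0X X : concat empty_comp X = X.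
Proof. by apply: val_inj; case: X => [[]]. Qed.

Lemma concatX0 X : concat X empty_comp = X.
Proof. by apply: val_inj; case: X => [[d lam] p]; rewrite /= addn0 cats0. Qed.

Definition coset_join m n lam mu (A : ycoset m lam) (B : ycoset n mu) :
    ycoset (m + n) (lam ++ mu) :=
  mkcoset (lam ++ mu) (perm_sum (repr (val A)) (repr (val B))).

(* [outer] is the universal S_m x S_n-equivariant bilinear map
   M^lam x M^mu -> Ind (M^lam ⊠ M^mu), Ind (M^lam ⊠ M^mu) being identified with
   M^(lam, mu) through (S_lam s ⊠ S_mu t) ⊗ h |-> S_(lam, mu) (s × t) h. *)
Definition outer F m n lam mu (u : permmod F m lam) (v : permmod F n mu) :
    permmod F (m + n) (lam ++ mu) :=
  \sum_A \sum_B (u A * v B) *: bvec F (coset_join A B).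

Lemma outerEl F m n lam mu (u : permmod F m lam) (v : permmod F n mu) :
  outer u v = linext (fun A => \sum_B v B *: bvec F (coset_join A B)) u.
Proof.
rewrite linextE; apply: eq_bigr => A _.
rewrite scaler_sumr.
by apply: eq_bigr => B _; rewrite scalerA.
Qed.

Lemma outerEr F m n lam mu (u : permmod F m lam) (v : permmod F n mu) :
  outer u v = linext (fun B => \sum_A u A *: bvec F (coset_join A B)) v.
Proof.
rewrite linextE /outer exchange_big; apply: eq_bigr => A _.
rewrite scaler_sumr.
by apply: eq_bigr => B _; rewrite scalerA mulrC.
Qed.

Lemma outer0l F m n lam mu v : @outer F m n lam mu 0 v = 0.
Proof. by rewrite outerEl linear0. Qed.

Lemma outer0r F m n lam mu u : @outer F m n lam mu u 0 = 0.
Proof. by rewrite outerEr linear0. Qed.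

Lemma outer_suml F m n lam mu (I : finType) (a : I -> F) w v :
  @outer F m n lam mu (\sum_i a i *: w i) v = \sum_i a i *: outer (w i) v.
Proof.
rewrite outerEl linear_sum; apply: eq_bigr => i _.
by rewrite linearZ outerEl.
Qed.

Lemma outer_sumr F m n lam mu (I : finType) (a : I -> F) w u :
  @outer F m n lam mu u (\sum_i a i *: w i) = \sum_i a i *: outer u (w i).
Proof.
rewrite outerEr linear_sum; apply: eq_bigr => i _.
by rewrite linearZ outerEr.
Qed.

Lemma outer_bvec F m n lam mu (A : ycoset m lam) (B : ycoset n mu) :
  outer (bvec F A) (bvec F B) = bvec F (coset_join A B).
Proof.
rewrite outerEl (@linext_bvec F) (bigD1 B) //= (@bvecE F) eqxx scale1r big1 ?addr0 //.
by move=> C /negPf CB; rewrite (@bvecE F) CB scale0r.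
Qed.

Lemma coset_join_mkcoset m n lam mu (s : 'S_m) (t : 'S_n) :
  sumn lam = m -> sumn mu = n ->
  coset_join (mkcoset lam s) (mkcoset mu t) = mkcoset _ (perm_sum s t).
Proof.
move=> lamm mun; rewrite /coset_join.
have [x xY ->] := repr_mkcosetP s lamm; have [y yY ->] := repr_mkcosetP t mun.
by rewrite perm_sumM mkcoset_young ?young_cat ?xY ?sumn_cat ?lamm ?mun.
Qed.

Lemma outer_permact F m n lam mu (s : 'S_m) (t : 'S_n)
    (u : permmod F m lam) (v : permmod F n mu) :
  sumn lam = m -> sumn mu = n ->
  outer (permact F lam s u) (permact F mu t v) =
  permact F (lam ++ mu) (perm_sum s t) (outer u v).
Proof.
move=> lamm mun; rewrite (lfun_bvec _ u) (lfun_bvec _ v) {2}[u]ffun_bvec.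
rewrite !outer_suml linear_sum; apply: eq_bigr => A _; rewrite linearZ /=.
congr (_ *: _); rewrite {2}[v]ffun_bvec !outer_sumr linear_sum.
apply: eq_bigr => B _; rewrite linearZ /=; congr (_ *: _).
rewrite !(@permact_bvec F) !outer_bvec (@permact_bvec F); congr (bvec F _).
rewrite (repr_mkcoset A lamm) (repr_mkcoset B mun). rewrite (@coset_act_mkcoset m lam) (@coset_act_mkcoset n mu).
by rewrite !coset_join_mkcoset // (@coset_act_mkcoset (m + n)) perm_sumM.
Qed.

Lemma perm_homE F X Y (f : perm_hom F X Y) (e : wt X = wt Y) g v :
  f (permact F (parts X) g v) = permact F (parts Y) (cast_perm e g) (f v).
Proof.
case: f => f /equivariantP /=; case: eqP => // e' fP.
by rewrite -comp_lfunE fP comp_lfunE (eq_irrelevance e e').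
Qed.

Lemma perm_hom0 F X Y (f : perm_hom F X Y) : wt X <> wt Y -> f = 0 :> 'Hom(_, _).
Proof. by case: f => f /equivariantP /=; case: eqP. Qed.

Lemma cast_perm_sum m m' n n' (em : m = m') (en : n = n') e (s : 'S_m) (t : 'S_n) :
  cast_perm e (perm_sum s t) =
  perm_sum (cast_perm em s) (cast_perm en t) :> 'S_(m' + n').
Proof. by case: m' / em e; case: n' / en => e; rewrite !cast_perm_id. Qed.

(* Ind (f ⊠ g) sends S_(lam, mu) h to (f S_lam ⊠ g S_mu) h; see [tensE]. *)
Definition tens_val F X X' Y Y' (f : perm_hom F X X') (g : perm_hom F Y Y') :
    'Hom(permmod F (wt (concat X Y)) (parts (concat X Y)),
         permmod F (wt (concat X' Y')) (parts (concat X' Y'))) :=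
  match wt (concat X Y) =P wt (concat X' Y') with
  | ReflectT e => linext (fun A =>
      permact F _ (cast_perm e (repr (val A)))
        (outer (f (bvec F (mkcoset (parts X) 1)))
               (g (bvec F (mkcoset (parts Y) 1)))))
  | ReflectF _ => 0
  end.

Section Tens.
Variables (F : fieldType) (X X' Y Y' : composition).
Variables (f : perm_hom F X X') (g : perm_hom F Y Y').
Hypothesis e : wt (concat X Y) = wt (concat X' Y').

Let w := outer (f (bvec F (mkcoset (parts X) 1)))
               (g (bvec F (mkcoset (parts Y) 1))).

Lemma tens_sum s t :
  permact F _ (cast_perm e (perm_sum s t)) w =
  outer (f (bvec F (mkcoset (parts X) s))) (g (bvec F (mkcoset (parts Y) t))).
Proof.
rewrite /w; have [eX|nX] := wt X =P wt X'; last first.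
  by rewrite (perm_hom0 f nX) !zero_lfunE !outer0l linear0.
have eY : wt Y = wt Y' by apply/eqP; rewrite -(eqn_add2l (wt X)) {2}eX; apply/eqP.
rewrite (cast_perm_sum eX eY) -outer_permact ?sumn_parts // -!perm_homE.
by rewrite !(@permact_bvec F) !coset_act_mkcoset !mul1g.
Qed.

Lemma tens_fix s : s \in young (wt X + wt Y) (parts X ++ parts Y) ->
  permact F _ (cast_perm e s) w = w.
Proof.
case/young_cat_split; rewrite ?sumn_parts // => x [y [xY yY ->]].
by rewrite tens_sum -[x]mulg1 -[y]mulg1 !mkcoset_young ?sumn_parts.
Qed.

Lemma tens_mkcoset h :
  tens_val f g (bvec F (mkcoset _ h)) = permact F _ (cast_perm e h) w.
Proof.
rewrite /tens_val; case: eqP => // e'; rewrite (@linext_bvec F).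
have lmd : sumn (parts X ++ parts Y) = (wt X + wt Y)%N by rewrite (eqP (concat_subproof _ _)).
have [s sY ->] := repr_mkcosetP h lmd.
by rewrite (eq_irrelevance e' e) cast_perm_morphM permactM -/w (tens_fix sY).
Qed.
End Tens.

Lemma tens_subproof F X X' Y Y' (f : perm_hom F X X') (g : perm_hom F Y Y') :
  tens_val f g \in equivariant F (concat X Y) (concat X' Y').
Proof.
apply/equivariantP; case: eqP => [e h|ne]; last by rewrite /tens_val; case: eqP.
apply: (@eq_lfun_bvec F (ycoset (wt (concat X Y)) (parts (concat X Y)))) => A.
rewrite !comp_lfunE (@permact_bvec F) (repr_mkcoset A (sumn_parts (concat X Y))).
rewrite coset_act_mkcoset !(tens_mkcoset _ _ e).
by rewrite cast_perm_morphM permactM.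
Qed.

Definition perm_tens F X X' Y Y' (f : perm_hom F X X') (g : perm_hom F Y Y') :
  perm_hom F (concat X Y) (concat X' Y') := PermHom (tens_subproof f g).

Lemma tensE F X X' Y Y' (f : perm_hom F X X') (g : perm_hom F Y Y')
    (e : wt (concat X Y) = wt (concat X' Y')) h u v :
  perm_tens f g (permact F _ h (outer u v)) =
  permact F _ (cast_perm e h) (outer (f u) (g v)).
Proof.
rewrite (lfun_bvec f u) (lfun_bvec g v) {1}[u]ffun_bvec.
rewrite !outer_suml !linear_sum; apply: eq_bigr => A _; rewrite !linearZ /=.
congr (_ *: _); rewrite {1}[v]ffun_bvec !outer_sumr !linear_sum.
apply: eq_bigr => B _; rewrite !linearZ /=; congr (_ *: _).
rewrite (repr_mkcoset A (sumn_parts X)) (repr_mkcoset B (sumn_parts Y)).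
rewrite outer_bvec coset_join_mkcoset ?sumn_parts // (@permact_bvec F).
rewrite coset_act_mkcoset (tens_mkcoset _ _ e) cast_perm_morphM permactM.
by rewrite tens_sum.
Qed.

(* Associators and unitors are the identifications coming from equality of
   compositions. *)
Definition PermCat F : monoidal_data := {|
  obj := composition;
  mor := perm_hom F;
  idmor := perm_id F;
  cmp := @perm_cmp F;
  unit_obj := empty_comp;
  tens := concat;
  tensm := @perm_tens F;
  assoc := fun X Y Z => perm_cast F (concatA X Y Z);
  assocV := fun X Y Z => perm_cast F (esym (concatA X Y Z));
  lunit := fun X => perm_cast F (concat0X X);
  runit := fun X => perm_cast F (concatX0 X) |}.

Definition row_comp (k : nat) : composition :=
  exist _ (k, [:: k]) (introT eqP (addn0 k)).

(* Identity if [X = Y]; the value for [X <> Y] is junk. *)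
Definition relabel F (X Y : PermCat F) : mor X Y :=
  if X =P Y :> composition is ReflectT e then perm_cast F e else 0.

Definition Mrow F (k : nat) : PermCat F := row_comp k.

Definition nabla_val F k l :
    'Hom(permmod F (k + l) [:: k; l], permmod F (k + l) [:: (k + l)%N]) :=
  linext (fun A => bvec F (mkcoset [:: (k + l)%N] 1)).

Definition Delta_val F k l :
    'Hom(permmod F (k + l) [:: (k + l)%N], permmod F (k + l) [:: k; l]) :=
  linext (fun A =>
    (k`! * l`!)%:R^-1 *: \sum_(g : 'S_(k + l)) bvec F (mkcoset [:: k; l] g)).

Lemma coset_row m (A B : ycoset m [:: m]) : A = B.
Proof.
have mm : sumn [:: m] = m by rewrite /= addn0.
rewrite (repr_mkcoset A mm) (repr_mkcoset B mm).
move: (repr _) (repr _) => s t; rewrite -[s](mulgKV t) mkcoset_young //.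
by apply/mem_youngP => // -[|j] i; rewrite ?take0 //= addn0 !ltn_ord.
Qed.

Lemma nabla_subproof F k l :
  nabla_val F k l \in equivariant F (concat (row_comp k) (row_comp l))
                                    (row_comp (k + l)).
Proof.
apply/equivariantP; case: eqP => // e g.
apply: (@eq_lfun_bvec F (ycoset (k + l) [:: k; l])) => A.
rewrite !comp_lfunE (@permact_bvec F) !(@linext_bvec F).
congr (@bvec F (ycoset (k + l) [:: (k + l)%N]) _); exact: coset_row.
Qed.

Lemma Delta_subproof F k l :
  Delta_val F k l \in equivariant F (row_comp (k + l))
                                    (concat (row_comp k) (row_comp l)).
Proof.
apply/equivariantP; case: eqP => // e g.
apply: (@eq_lfun_bvec F (ycoset (k + l) [:: (k + l)%N])) => A.
rewrite !comp_lfunE (@permact_bvec F) !(@linext_bvec F) linearZ; congr (_ *: _).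
rewrite linear_sum /= (reindex_inj (mulIg g)); apply: eq_bigr => h _ /=.
by rewrite (@permact_bvec F (k + l) [:: k; l]) coset_act_mkcoset cast_perm_id.
Qed.

Definition nabla F k l : mor (Mrow F k ⊗ Mrow F l) (Mrow F (k + l)) :=
  PermHom (nabla_subproof F k l).

Definition Delta F k l : mor (Mrow F (k + l)) (Mrow F k ⊗ Mrow F l) :=
  PermHom (Delta_subproof F k l).

(* Both operators vanish when an index would be negative; so in a sum of
   [E^(b) F^(a)] over all [a, b >= 0] with [a - b = k - l] only the terms with
   [a <= k], and hence [b <= l], can be nonzero. *)
Definition Fpow F (a k l : nat) :
    mor (Mrow F k ⊗ Mrow F l) (Mrow F (k - a) ⊗ Mrow F (l + a)) :=
  if (a <= k)%N then
    (idmor (Mrow F (k - a)) ⊠ (relabel (Mrow F (a + l)) (Mrow F (l + a)) ⋅ nabla F a l))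
    ⋅ assoc (Mrow F (k - a)) (Mrow F a) (Mrow F l)
    ⋅ ((Delta F (k - a) a ⋅ relabel (Mrow F k) (Mrow F (k - a + a))) ⊠ idmor (Mrow F l))
  else 0 : perm_hom F _ _.

Definition Epow F (b k l : nat) :
    mor (Mrow F k ⊗ Mrow F l) (Mrow F (k + b) ⊗ Mrow F (l - b)) :=
  if (b <= l)%N then
    (nabla F k b ⊠ idmor (Mrow F (l - b)))
    ⋅ assocV (Mrow F k) (Mrow F b) (Mrow F (l - b))
    ⋅ (idmor (Mrow F k) ⊠ (Delta F b (l - b) ⋅ relabel (Mrow F l) (Mrow F (b + (l - b)))))
  else 0 : perm_hom F _ _.

(* Main.v *)
Require Import Defs.
From HB Require Import structures.
From mathcomp Require Import all_boot all_order all_fingroup all_algebra.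
From mathcomp Require Import reals complex zify.
Set Implicit Arguments.
Unset Strict Implicit.
Unset Printing Implicit Defensive.
Import GRing.Theory.
Local Open Scope ring_scope.
Local Open Scope moncat_scope.

(** The module of a composition [lam] of [d] has for basis the words of length [d]
    with content [lam], the coset of [h] being the word that carries its first
    letter at the images under [h] of the first [lam_1] points, and so on. The
    monoidal product concatenates alphabets: [f ⊠ g] rewrites the letters of the
    first alphabet by [f] and those of the second by [g]. Associators and unitors
    are identities up to equality of compositions, so pentagon and triangle are
    proof irrelevance ([cast_irr]). The braiding [braid] leaves the positions in
    place and exchanges the two alphabets; on cosets it is left translation by
    [block_swap]. It is natural because [f ⊠ g] treats the two alphabets
    independently ([braid_outer]), and the hexagons and symmetry are identities
    between permutations of blocks of integers ([acts_by_inj],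
    [block_swap_catr], [block_swap_catl]).

    For the formula, a word with content [(k, l)] is the set [A] of the [k]
    positions of its first letter ([head_set]). Then
     - the braiding sends [A] to its complement ([has_matrix_braid]);
     - [F^(a)] sends [A] to the sum of its subsets of size [k - a]
       ([has_matrix_Fpow]), the factorials in [Delta] cancelling the
       multiplicity with which permutations produce a given subset;
     - [E^(b)] sends [A] to the sum of its supersets of size [k + b]
       ([has_matrix_Epow]).

    Hence the coefficient of [B] in [E^(b) F^(a) A] is the number of subsets of
    size [k - a] of [A :&: B], and in [F^(b) E^(a) A] the number of supersets of
    size [k + a] of [A :|: B]; by complementation the latter is the number of
    subsets of size [l - a] of a set of the same cardinality as [A :&: B]. In both
    cases the signed sum is an alternating sum of all binomial coefficients of
    the number of elements of [A :&: B]. It is 1 if [A] and [B] are disjoint,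
    that is complementary, and 0 otherwise, as for the braiding. *)

(** * Permutations acting on all natural numbers *)

(** Extending a permutation of the first [n] integers by the identity forgets
    [n]. Permutations living in different but equal symmetric groups become
    comparable, [cast_perm] disappears, and identities between block permutations
    become linear arithmetic. *)
Definition nact n (s : 'S_n) (x : nat) : nat :=
  if insub x is Some i then val (s i) else x.

Lemma nact_ord n (s : 'S_n) (i : 'I_n) : nact s i = s i.
Proof. by rewrite /nact valK. Qed.

Lemma nact_out n (s : 'S_n) x : (n <= x)%N -> nact s x = x.
Proof. by move=> nx; rewrite /nact insubF // ltnNge nx. Qed.

Lemma nact_inj n (s t : 'S_n) : nact s =1 nact t -> s = t.
Proof.
by move=> st; apply/permP => i; apply: val_inj; rewrite /= -!nact_ord st.
Qed.

Lemma nact_lshift m n (s : 'S_(m + n)) (i : 'I_m) : nact s i = s (lshift n i).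
Proof. by rewrite -nact_ord. Qed.

Lemma nact_rshift m n (s : 'S_(m + n)) (i : 'I_n) :
  nact s (m + i)%N = s (rshift m i).
Proof. by rewrite -nact_ord. Qed.

Lemma nact_cast m n (e : m = n) (s : 'S_m) : nact (cast_perm e s) = nact s.
Proof. by case: n / e; rewrite cast_perm_id. Qed.

Lemma nactM n (s t : 'S_n) x : nact (s * t)%g x = nact t (nact s x).
Proof.
have [xn|nx] := ltnP x n; last by rewrite !nact_out.
by rewrite -[x]/(val (Ordinal xn)) !nact_ord permM.
Qed.

Lemma nact1 n x : nact (1%g : 'S_n) x = x.
Proof.
have [xn|nx] := ltnP x n; last by rewrite nact_out.
by rewrite -[x]/(val (Ordinal xn)) nact_ord perm1.
Qed.

Lemma nact_lt n (s : 'S_n) x : (nact s x < n)%N = (x < n)%N.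
Proof.
have [xn|nx] := ltnP x n; last by rewrite nact_out // ltnNge nx.
by rewrite -[x]/(val (Ordinal xn)) nact_ord ltn_ord.
Qed.

Lemma nactK n (s : 'S_n) : cancel (nact s) (nact s^-1).
Proof. by move=> x; rewrite -nactM mulgV nact1. Qed.

Lemma nactKV n (s : 'S_n) : cancel (nact s^-1) (nact s).
Proof. by move=> x; rewrite -nactM mulVg nact1. Qed.

Lemma nact_sum m n (s : 'S_m) (t : 'S_n) x :
  nact (perm_sum s t) x = if (x < m)%N then nact s x else (m + nact t (x - m))%N.
Proof.
have [xm|mx] := ltnP x m.
  by rewrite -[x]/(val (Ordinal xm)) nact_lshift perm_sum_lshift /= -nact_ord.
have [xn|nx] := ltnP (x - m) n; last by rewrite !nact_out; lia.
have -> : x = rshift m (Ordinal xn) by rewrite /= subnKC.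
by rewrite nact_ord perm_sum_rshift /= addKn -nact_ord.
Qed.

Lemma nact_sumA m n p (r : 'S_m) (s : 'S_n) (t : 'S_p) x :
  nact (perm_sum (perm_sum r s) t) x = nact (perm_sum r (perm_sum s t)) x.
Proof.
rewrite !nact_sum !subnDA; have [lt_m|le_m] := ltnP x m.
  by rewrite ltn_addr.
by rewrite -(ltn_subLR _ le_m); case: ifP; rewrite ?addnA.
Qed.

Definition block_swap_fun m n (i : 'I_(n + m)) : 'I_(n + m) :=
  cast_ord (addnC m n)
    (match split i with inl j => rshift m j | inr j => lshift n j end).

Lemma block_swap_fun_val m n (i : 'I_(n + m)) :
  block_swap_fun i = (if (i < n)%N then i + m else i - n)%N :> nat.
Proof.
rewrite /block_swap_fun /=; case: split_ordP => j -> /=; first by rewrite addnC.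
by rewrite addKn.
Qed.

Lemma block_swap_inj m n : injective (@block_swap_fun m n).
Proof.
move=> i j ij.
have {ij} : block_swap_fun i = block_swap_fun j :> nat by rewrite ij.
rewrite !block_swap_fun_val => ij; apply: val_inj => /=.
have := ltn_ord i; have := ltn_ord j; move: ij; do 2 case: ltnP => ?; lia.
Qed.

(** Translating the coset of [h] by it on the left exchanges the alphabets of the
    corresponding word and leaves the positions in place, since it sends the
    first [n] points behind the last [m] ones. *)
Definition block_swap m n : 'S_(n + m) := perm (@block_swap_inj m n).

Lemma nact_swap m n x : nact (block_swap m n) x =
  if (x < n)%N then (x + m)%N else if (x < n + m)%N then (x - n)%N else x.
Proof.
have [xnm|nx] := ltnP x (n + m); last first.
  by rewrite nact_out // ltnNge (leq_trans _ nx) ?leq_addr.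
by rewrite -[x]/(val (Ordinal xnm)) nact_ord permE block_swap_fun_val.
Qed.

Lemma perm_sum1 m n : perm_sum (1%g : 'S_m) (1%g : 'S_n) = 1%g.
Proof.
by apply: nact_inj => x; rewrite nact_sum !nact1; case: ltnP; lia.
Qed.

(* Splits the innermost comparisons first, so that every condition that is split
   is free of conditionals and usable by [lia]. *)
Ltac case_ltn := repeat match goal with
  | |- context [if (?a < ?b)%N then _ else _] =>
    lazymatch a with
    | context [if _ then _ else _] => fail
    | _ => case: (ltnP a b) => ?
    end
  end.

(** The two hexagons at the level of permutations: a block can be moved across two
    blocks one at a time. *)
Lemma block_swap_catr m n p x : nact (block_swap m (n + p)) x =
  nact (perm_sum (block_swap m n) (1%g : 'S_p))
       (nact (perm_sum (1%g : 'S_n) (block_swap m p)) x).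
Proof. by rewrite !nact_sum !nact1 !nact_swap; case_ltn; lia. Qed.

Lemma block_swap_catl m n p x : nact (block_swap (m + n) p) x =
  nact (perm_sum (1%g : 'S_m) (block_swap n p))
       (nact (perm_sum (block_swap m p) (1%g : 'S_n)) x).
Proof. by rewrite !nact_sum !nact1 !nact_swap; case_ltn; lia. Qed.

(** Makes the braiding well defined on cosets and compatible with [outer]. *)
Lemma perm_sum_swap m n (s : 'S_m) (t : 'S_n) :
  (block_swap m n * cast_perm (addnC m n) (perm_sum s t))%g =
  (perm_sum t s * block_swap m n)%g.
Proof.
apply: nact_inj => x; rewrite !nactM nact_cast !nact_sum !nact_swap.
have lt_s y : (nact s y < m)%N = (y < m)%N by exact: nact_lt.
have lt_t y : (nact t y < n)%N = (y < n)%N by exact: nact_lt.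
have [lt_n|le_n] := ltnP x n.
  by rewrite ltnNge leq_addl /= addnK lt_t lt_n addnC.
have [lt_nm|le_nm] := ltnP x (n + m).
  have lt : (x - n < m)%N by lia.
  by rewrite lt [in RHS]ltnNge leq_addr /= ltn_add2l lt_s lt addKn.
have [lt_m|le_m] := ltnP x m; first by lia.
rewrite !nact_out; try lia.
by case_ltn; lia.
Qed.

(** * The monoidal category of permutation modules *)

Section Perm.
Variable F : fieldType.
Implicit Types X Y Z : composition.

(** The basis vector of a coset, indexed by any representative, so that right
    translations and concatenations can be computed on permutations. *)
Definition cvec X (h : 'S_(wt X)) : permmod F (wt X) (parts X) :=
  bvec F (mkcoset (parts X) h).

Lemma eq_cvec X Y (f g : perm_hom F X Y) :
  (forall h, f (cvec h) = g (cvec h)) -> f = g.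
Proof.
move=> fg; apply: val_inj.
apply: (@eq_lfun_bvec F (ycoset (wt X) (parts X))) => A.
by rewrite (repr_mkcoset A (sumn_parts X)); exact: fg.
Qed.

Lemma perm_cmpE X Y Z (g : perm_hom F Y Z) (f : perm_hom F X Y) v :
  perm_cmp g f v = g (f v).
Proof. by rewrite /= comp_lfunE. Qed.

Lemma perm_idE X v : perm_id F X v = v.
Proof. by rewrite /= id_lfunE. Qed.

Lemma permact_cvec X (g h : 'S_(wt X)) :
  permact F (parts X) g (cvec h) = cvec (h * g)%g.
Proof. by rewrite /cvec (@permact_bvec F) coset_act_mkcoset. Qed.

Lemma outer_cvec X Y (s : 'S_(wt X)) (t : 'S_(wt Y)) :
  outer (cvec s) (cvec t) = cvec (X := concat X Y) (perm_sum s t).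
Proof. by rewrite /cvec outer_bvec coset_join_mkcoset ?sumn_parts. Qed.

Lemma cvec_outer X Y (h : 'S_(wt (concat X Y))) :
  cvec h = permact F (parts X ++ parts Y) h
             (outer (cvec (X := X) 1%g) (cvec (X := Y) 1%g)).
Proof. by rewrite outer_cvec (@permact_cvec (concat X Y)) perm_sum1 mul1g. Qed.

Lemma perm_tens0l X X' Y Y' (g : perm_hom F Y Y') :
  perm_tens (0 : perm_hom F X X') g = 0.
Proof.
apply: eq_cvec => h; rewrite [RHS]zero_lfunE.
have [e|ne] := wt (concat X Y) =P wt (concat X' Y').
  by rewrite cvec_outer (tensE _ _ e) zero_lfunE outer0l linear0.
by rewrite perm_hom0 // zero_lfunE.
Qed.

Lemma perm_tens0r X X' Y Y' (f : perm_hom F X X') :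
  perm_tens f (0 : perm_hom F Y Y') = 0.
Proof.
apply: eq_cvec => h; rewrite [RHS]zero_lfunE.
have [e|ne] := wt (concat X Y) =P wt (concat X' Y').
  by rewrite cvec_outer (tensE _ _ e) zero_lfunE outer0r linear0.
by rewrite perm_hom0 // zero_lfunE.
Qed.

(** Lets every naturality statement be checked only when each factor preserves
    the degree, even though a tensor product may preserve the total degree while
    its factors do not. *)
Lemma wt_eq_or_hom0 X Y (f : perm_hom F X Y) : wt X = wt Y \/ f = 0.
Proof.
have [e|ne] := wt X =P wt Y; first by left.
by right; apply: val_inj; apply: perm_hom0.
Qed.

Lemma perm_cmp0l X Y Z (f : perm_hom F X Y) :
  perm_cmp (0 : perm_hom F Y Z) f = 0.
Proof. by apply: val_inj; rewrite /= comp_lfun0l. Qed.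

Lemma perm_cmp0r X Y Z (g : perm_hom F Y Z) :
  perm_cmp g (0 : perm_hom F X Y) = 0.
Proof. by apply: val_inj; rewrite /= comp_lfun0r. Qed.

Lemma perm_category : is_category (PermCat F).
Proof.
split=> [X Y f|X Y f|X Y Z W h g f]; apply: val_inj.
- exact: comp_lfun1l.
- exact: comp_lfun1r.
exact: comp_lfunA.
Qed.

Lemma perm_tens_id X Y :
  perm_tens (perm_id F X) (perm_id F Y) = perm_id F (concat X Y).
Proof.
apply: eq_cvec => h.
rewrite perm_idE {1}cvec_outer (tensE _ _ (erefl _)) cast_perm_id.
by rewrite !perm_idE -cvec_outer.
Qed.

Lemma perm_tens_cmp X X' X'' Y Y' Y''
    (f : perm_hom F X X') (f' : perm_hom F X' X'')
    (g : perm_hom F Y Y') (g' : perm_hom F Y' Y'') :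
  perm_tens (perm_cmp f' f) (perm_cmp g' g) =
  perm_cmp (perm_tens f' g') (perm_tens f g).
Proof.
have [eX|->] := wt_eq_or_hom0 f; last by rewrite !(perm_cmp0r, perm_tens0l).
have [eX'|->] := wt_eq_or_hom0 f'; last by rewrite !(perm_cmp0l, perm_tens0l).
have [eY|->] := wt_eq_or_hom0 g; last by rewrite !(perm_cmp0r, perm_tens0r).
have [eY'|->] := wt_eq_or_hom0 g'; last by rewrite !(perm_cmp0l, perm_tens0r).
have e : wt (concat X Y) = wt (concat X' Y') by congr (_ + _)%N.
have e' : wt (concat X' Y') = wt (concat X'' Y'') by congr (_ + _)%N.
apply: eq_cvec => h; rewrite perm_cmpE cvec_outer (tensE _ _ e) (tensE _ _ e').
rewrite (tensE _ _ (etrans e e')) !perm_cmpE; congr (permact F _ _ _).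
by apply: nact_inj => x; rewrite !nact_cast.
Qed.

Lemma cast_cvec X Y (e : X = Y) (h : 'S_(wt X)) :
  perm_cast F e (cvec h) = cvec (cast_perm (congr1 wt e) h).
Proof. by case: Y / e; rewrite perm_idE cast_perm_id. Qed.

(** Equality of compositions is decidable, hence its proofs are all equal; with
    [cast_cmp] and [cast_tens] this is the whole coherence theory of the
    associators and unitors. *)
Lemma cast_irr X Y (e e' : X = Y) : perm_cast F e = perm_cast F e'.
Proof. by rewrite (eq_irrelevance e e'). Qed.

Lemma cast_cmp X Y Z (e : X = Y) (e' : Y = Z) :
  perm_cmp (perm_cast F e') (perm_cast F e) = perm_cast F (etrans e e').
Proof.
by case: Z / e'; case: Y / e; apply: val_inj; rewrite /= comp_lfun1l.
Qed.

Lemma cast_tens X X' Y Y' (e : X = X') (e' : Y = Y') :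
  perm_tens (perm_cast F e) (perm_cast F e') =
  perm_cast F (f_equal2 concat e e').
Proof.
case: X' / e; case: Y' / e'.
by rewrite perm_tens_id (cast_irr (f_equal2 _ _ _) erefl).
Qed.

Lemma cast_permact X Y (e : X = Y) g v :
  perm_cast F e (permact F (parts X) g v) =
  permact F (parts Y) (cast_perm (congr1 wt e) g) (perm_cast F e v).
Proof. exact: perm_homE. Qed.

Lemma cvec_sum X (v : permmod F (wt X) (parts X)) :
  exists a : ycoset (wt X) (parts X) -> F,
    v = \sum_A a A *: cvec (repr (val A)).
Proof.
exists v; rewrite {1}[v]ffun_bvec; apply: eq_bigr => A _.
by rewrite {2}(repr_mkcoset A (sumn_parts X)).
Qed.

(** Strict associativity and unitality of [outer]; naturality of the structural
    isomorphisms follows from these and from equivariance. *)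
Lemma cast_outerA X Y Z (u : permmod F (wt X) (parts X))
    (v : permmod F (wt Y) (parts Y)) (w : permmod F (wt Z) (parts Z)) :
  perm_cast F (concatA X Y Z)
    (outer (outer u v : permmod F (wt (concat X Y)) (parts (concat X Y))) w) =
  outer u (outer v w : permmod F (wt (concat Y Z)) (parts (concat Y Z))).
Proof.
have [a ->] := cvec_sum u; rewrite !outer_suml linear_sum; apply: eq_bigr => A _.
rewrite linearZ /=; congr (_ *: _).
have [b ->] := cvec_sum v.
rewrite outer_suml !outer_sumr !outer_suml linear_sum; apply: eq_bigr => B _.
rewrite linearZ /=; congr (_ *: _).
have [c ->] := cvec_sum w; rewrite !outer_sumr linear_sum; apply: eq_bigr => C _.
rewrite linearZ /=; congr (_ *: _).
rewrite !outer_cvec cast_cvec.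
congr cvec; apply: nact_inj => x; rewrite nact_cast; exact: nact_sumA.
Qed.
Lemma cast_outer0 X (v : permmod F (wt X) (parts X)) :
  perm_cast F (concat0X X) (outer (cvec (X := empty_comp) 1%g) v) = v.
Proof.
have [a ->] := cvec_sum v; rewrite outer_sumr linear_sum; apply: eq_bigr => A _.
rewrite linearZ /= outer_cvec cast_cvec; congr (_ *: cvec _).
by apply: nact_inj => x; rewrite nact_cast nact_sum /= subn0 add0n.
Qed.

Lemma cast_outer1 X (v : permmod F (wt X) (parts X)) :
  perm_cast F (concatX0 X) (outer v (cvec (X := empty_comp) 1%g)) = v.
Proof.
have [a ->] := cvec_sum v; rewrite outer_suml linear_sum; apply: eq_bigr => A _.
rewrite linearZ /= outer_cvec cast_cvec; congr (_ *: cvec _).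
apply: nact_inj => x; rewrite nact_cast nact_sum nact1.
by have [//|le] := ltnP x (wt X); rewrite subnKC // nact_out.
Qed.

Lemma cvec1_outer X Y :
  cvec (X := concat X Y) 1%g =
  outer (cvec (X := X) 1%g) (cvec (X := Y) 1%g).
Proof. by rewrite outer_cvec perm_sum1. Qed.

Lemma permact1 X v : permact F (parts X) (1%g : 'S_(wt X)) v = v.
Proof.
have [a ->] := cvec_sum v; rewrite linear_sum; apply: eq_bigr => A _.
by rewrite linearZ /= permact_cvec mulg1.
Qed.

Lemma tens_outer X X' Y Y' (f : perm_hom F X X') (g : perm_hom F Y Y') u v :
  wt (concat X Y) = wt (concat X' Y') ->
  perm_tens f g (outer u v) = outer (f u) (g v).
Proof.
move=> e; rewrite -{1}[outer u v](@permact1 (concat X Y)) (tensE _ _ e).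
have -> : cast_perm e 1 = 1%g.
  by apply: nact_inj => x; rewrite nact_cast !nact1.
exact: (@permact1 (concat X' Y')).
Qed.

Lemma perm_assoc_natural X X' Y Y' Z Z'
    (f : perm_hom F X X') (g : perm_hom F Y Y') (h : perm_hom F Z Z') :
  perm_cmp (perm_cast F (concatA X' Y' Z')) (perm_tens (perm_tens f g) h) =
  perm_cmp (perm_tens f (perm_tens g h)) (perm_cast F (concatA X Y Z)).
Proof.
pose zeroE := (perm_tens0l, perm_tens0r, perm_cmp0r, perm_cmp0l).
have [eX|->] := wt_eq_or_hom0 f; last by rewrite !zeroE.
have [eY|->] := wt_eq_or_hom0 g; last by rewrite !zeroE.
have [eZ|->] := wt_eq_or_hom0 h; last by rewrite !zeroE.
have e1 : wt (concat X Y) = wt (concat X' Y') by congr (_ + _)%N.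
have e2 : wt (concat Y Z) = wt (concat Y' Z') by congr (_ + _)%N.
have e3 : wt (concat (concat X Y) Z) = wt (concat (concat X' Y') Z').
  by congr (_ + _)%N.
have e4 : wt (concat X (concat Y Z)) = wt (concat X' (concat Y' Z')).
  by congr (_ + _)%N.
apply: eq_cvec => s; rewrite !perm_cmpE cvec_outer (tensE _ _ e3) !cast_permact.
rewrite !cvec1_outer (tens_outer _ _ _ _ e1) !cast_outerA (tensE _ _ e4).
rewrite (tens_outer _ _ _ _ e2); congr (permact F _ _ _).
by apply: nact_inj => x; rewrite !nact_cast.
Qed.

Lemma perm_lunit_natural X Y (f : perm_hom F X Y) :
  perm_cmp (perm_cast F (concat0X Y)) (perm_tens (perm_id F empty_comp) f) =
  perm_cmp f (perm_cast F (concat0X X)).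
Proof.
have [e|->] := wt_eq_or_hom0 f; last by rewrite perm_tens0r perm_cmp0r perm_cmp0l.
apply: eq_cvec => s; rewrite !perm_cmpE cvec_outer.
rewrite (@tensE F empty_comp empty_comp X Y _ _ e) !cast_permact perm_idE.
rewrite !cast_outer0 (perm_homE f e); congr (permact F _ _ _).
by apply: nact_inj => x; rewrite !nact_cast.
Qed.

Lemma perm_runit_natural X Y (f : perm_hom F X Y) :
  perm_cmp (perm_cast F (concatX0 Y)) (perm_tens f (perm_id F empty_comp)) =
  perm_cmp f (perm_cast F (concatX0 X)).
Proof.
have [e|->] := wt_eq_or_hom0 f; last by rewrite perm_tens0l perm_cmp0r perm_cmp0l.
have e0 : wt (concat X empty_comp) = wt (concat Y empty_comp) by congr (_ + _)%N.
apply: eq_cvec => s; rewrite !perm_cmpE cvec_outer (tensE _ _ e0) !cast_permact.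
rewrite perm_idE !cast_outer1 (perm_homE f e); congr (permact F _ _ _).
by apply: nact_inj => x; rewrite !nact_cast.
Qed.

Lemma cast_iso X Y (e : X = Y) : @is_iso (PermCat F) X Y (perm_cast F e).
Proof.
exists (perm_cast F (esym e)).
by split; rewrite [LHS]cast_cmp (cast_irr _ erefl).
Qed.

Lemma perm_monoidal : is_monoidal (PermCat F).
Proof.
split.
- exact: perm_category.
- exact: perm_tens_id.
- by move=> *; exact: perm_tens_cmp.
- by move=> X Y Z; rewrite [LHS]cast_cmp (cast_irr _ erefl).
- by move=> X Y Z; rewrite [LHS]cast_cmp (cast_irr _ erefl).
- by move=> X; exact: cast_iso.
- by move=> X; exact: cast_iso.
- by move=> *; exact: perm_assoc_natural.
- by move=> *; exact: perm_lunit_natural.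
- by move=> *; exact: perm_runit_natural.
- move=> X Y Z W /=; rewrite -[perm_id F X]/(perm_cast F erefl).
  rewrite -[perm_id F W]/(perm_cast F erefl) !cast_tens !cast_cmp.
  exact: cast_irr.
move=> X Y /=; rewrite -[perm_id F X]/(perm_cast F erefl).
rewrite -[perm_id F Y]/(perm_cast F erefl) !cast_tens !cast_cmp.
exact: cast_irr.
Qed.

(** * The symmetric braiding *)

(** [outer u v] is sent to [outer v u] up to the block permutation that restores
    the positions; see [braid_outer]. *)
Definition braid_val X Y :
    'Hom(permmod F (wt (concat X Y)) (parts (concat X Y)),
         permmod F (wt (concat Y X)) (parts (concat Y X))) :=
  linext (fun A => cvec (X := concat Y X)
    (block_swap (wt X) (wt Y) *
     cast_perm (addnC (wt X) (wt Y)) (repr (val A)))%g).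

Lemma braid_val_cvec X Y (h : 'S_(wt (concat X Y))) :
  braid_val X Y (cvec h) =
  cvec (X := concat Y X)
    (block_swap (wt X) (wt Y) * cast_perm (addnC (wt X) (wt Y)) h)%g.
Proof.
rewrite /braid_val {1}/cvec (@linext_bvec F); congr bvec.
have [s sY ->] := repr_mkcosetP h (sumn_parts (concat X Y)).
have [x [y [xY yY ->]]] := young_cat_split (sumn_parts X) (sumn_parts Y) sY.
rewrite cast_perm_morphM mulgA perm_sum_swap -mulgA mkcoset_young //.
  exact: sumn_parts.
by rewrite /= young_cat ?sumn_parts // yY.
Qed.

Lemma braid_subproof X Y :
  braid_val X Y \in equivariant F (concat X Y) (concat Y X).
Proof.
apply/equivariantP; case: eqP => [e h|[]]; last exact: addnC.
apply: (@eq_lfun_bvec F (ycoset (wt (concat X Y)) (parts (concat X Y)))) => A.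
rewrite !comp_lfunE (repr_mkcoset A (sumn_parts (concat X Y))).
rewrite -[bvec F _]/(cvec _) permact_cvec !braid_val_cvec.
rewrite (@permact_cvec (concat Y X)).
congr cvec; apply: nact_inj => x; rewrite !(nactM, nact_cast) //.
Qed.

Definition braid X Y : perm_hom F (concat X Y) (concat Y X) :=
  PermHom (braid_subproof X Y).

Lemma braid_cvec X Y (h : 'S_(wt (concat X Y))) :
  braid X Y (cvec h) =
  cvec (X := concat Y X)
    (block_swap (wt X) (wt Y) * cast_perm (addnC (wt X) (wt Y)) h)%g.
Proof. exact: braid_val_cvec. Qed.

Lemma braid_outer X Y (u : permmod F (wt X) (parts X))
    (v : permmod F (wt Y) (parts Y)) :
  braid X Y (outer u v) =
  permact F (parts (concat Y X)) (block_swap (wt X) (wt Y)) (outer v u).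
Proof.
have [a ->] := cvec_sum u; rewrite outer_suml outer_sumr !linear_sum.
apply: eq_bigr => A _; rewrite !linearZ /=; congr (_ *: _).
have [b ->] := cvec_sum v; rewrite outer_suml outer_sumr !linear_sum.
apply: eq_bigr => B _; rewrite !linearZ /=; congr (_ *: _).
rewrite !outer_cvec braid_val_cvec (@permact_cvec (concat Y X)).
by rewrite perm_sum_swap.
Qed.

Lemma perm_braid_natural X X' Y Y' (f : perm_hom F X X') (g : perm_hom F Y Y') :
  perm_cmp (braid X' Y') (perm_tens f g) = perm_cmp (perm_tens g f) (braid X Y).
Proof.
pose zeroE := (perm_tens0l, perm_tens0r, perm_cmp0r, perm_cmp0l).
have [eX|->] := wt_eq_or_hom0 f; last by rewrite !zeroE.
have [eY|->] := wt_eq_or_hom0 g; last by rewrite !zeroE.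
have e : wt (concat X Y) = wt (concat X' Y') by congr (_ + _)%N.
have e' : wt (concat Y X) = wt (concat Y' X') by congr (_ + _)%N.
apply: eq_cvec => h; rewrite !perm_cmpE cvec_outer (tensE _ _ e).
rewrite (perm_homE (braid X Y) (addnC _ _)) (perm_homE (braid X' Y') (addnC _ _)).
rewrite !braid_outer -!permactM (tensE _ _ e'); congr (permact F _ _ _).
by apply: nact_inj => x; rewrite !(nact_cast, nactM, nact_swap) eX eY.
Qed.

(** Morphisms that permute the standard bases by left translation. They are closed
    under composition and tensor product, contain the structural isomorphisms and
    the braiding, and are determined by the permutation; a diagram of such
    morphisms commutes as soon as the permutations agree. *)
Definition acts_by X Y (f : perm_hom F X Y) (p : 'S_(wt Y)) : Prop :=
  exists e : wt X = wt Y, forall h, f (cvec h) = cvec (p * cast_perm e h)%g.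

Lemma acts_by_inj X Y (f g : perm_hom F X Y) (p q : 'S_(wt Y)) :
  acts_by f p -> acts_by g q -> nact p =1 nact q -> f = g.
Proof.
move=> [e fP] [e' gP] /nact_inj pq; apply: eq_cvec => h.
by rewrite fP gP pq (eq_irrelevance e e').
Qed.

Lemma acts_by_cmp X Y Z (g : perm_hom F Y Z) (f : perm_hom F X Y) p q :
  acts_by g q -> acts_by f p ->
  exists r, acts_by (perm_cmp g f) r /\ nact r =1 nact p \o nact q.
Proof.
move=> [e' gP] [e fP]; exists (q * cast_perm e' p)%g.
split=> [|x]; last by rewrite /= nactM nact_cast.
exists (etrans e e') => h; rewrite perm_cmpE fP gP; congr cvec.
by apply: nact_inj => x; rewrite !(nactM, nact_cast).
Qed.

Lemma acts_by_tens X X' Y Y' (f : perm_hom F X X') (g : perm_hom F Y Y') p q :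
  acts_by f p -> acts_by g q -> acts_by (perm_tens f g) (perm_sum p q).
Proof.
move=> [eX fP] [eY gP].
have e : wt (concat X Y) = wt (concat X' Y') by congr (_ + _)%N.
exists e => h; rewrite cvec_outer (tensE _ _ e) fP gP outer_cvec.
rewrite (@permact_cvec (concat X' Y')); congr cvec.
by apply: nact_inj => x; rewrite !(nactM, nact_sum, nact_cast, nact1).
Qed.

Lemma acts_by_cast X Y (e : X = Y) : acts_by (perm_cast F e) 1%g.
Proof. by exists (congr1 wt e) => h; rewrite cast_cvec mul1g. Qed.

Lemma acts_by_braid X Y : acts_by (braid X Y) (block_swap (wt X) (wt Y)).
Proof. by exists (addnC _ _) => h; rewrite braid_cvec. Qed.

Lemma perm_braiding : @is_symmetric_braiding (PermCat F) braid.
Proof.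
have sym X Y : perm_cmp (braid Y X) (braid X Y) = perm_id F (concat X Y).
  have [r [fP rE]] := acts_by_cmp (acts_by_braid Y X) (acts_by_braid X Y).
  apply: (acts_by_inj fP (acts_by_cast erefl)) => x.
  rewrite rE nact1 /= !nact_swap; case_ltn; lia.
split=> [X Y|X X' Y Y' f g|X Y Z|X Y Z|X Y].
- by exists (braid Y X); split; exact: sym.
- exact: perm_braid_natural.
- have [r [fP rE]] := acts_by_cmp
    (acts_by_cast (concatA Y Z X)) (acts_by_braid X (concat Y Z)).
  have [s [gP sE]] := acts_by_cmp fP (acts_by_cast (concatA X Y Z)).
  have [t [hP tE]] := acts_by_cmp
    (acts_by_tens (acts_by_cast (erefl Y)) (acts_by_braid X Z))
    (acts_by_cast (concatA Y X Z)).
  have [u [kP uE]] := acts_by_cmp hP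
    (acts_by_tens (acts_by_braid X Y) (acts_by_cast (erefl Z))).
  apply: (acts_by_inj gP kP) => x; rewrite sE uE /= rE tE /= !nact1.
  exact: block_swap_catr.
- have [r [fP rE]] := acts_by_cmp
    (acts_by_cast (esym (concatA Z X Y))) (acts_by_braid (concat X Y) Z).
  have [s [gP sE]] := acts_by_cmp fP (acts_by_cast (esym (concatA X Y Z))).
  have [t [hP tE]] := acts_by_cmp
    (acts_by_tens (acts_by_braid X Z) (acts_by_cast (erefl Y)))
    (acts_by_cast (esym (concatA X Z Y))).
  have [u [kP uE]] := acts_by_cmp hP
    (acts_by_tens (acts_by_cast (erefl X)) (acts_by_braid Y Z)).
  apply: (acts_by_inj gP kP) => x; rewrite sE uE /= rE tE /= !nact1.
  exact: block_swap_catl.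
exact: sym.
Qed.
End Perm.

(** * Cosets of two-row Young subgroups as subsets *)

Lemma card_lt_ord k l : #|[set i : 'I_(k + l) | (i < k)%N]| = k.
Proof.
have -> : [set i : 'I_(k + l) | (i < k)%N] = [set lshift l j | j in 'I_k].
  apply/setP => i; rewrite inE; apply/idP/imsetP => [ik|[j _ ->]] //=.
  by exists (Ordinal ik) => //; apply: val_inj.
by rewrite card_imset ?card_ord //; apply: lshift_inj.
Qed.

(** The positions of the first letter in the word of the coset of [h], for a
    two-row composition with first part [k]. The ambient size [D] is kept apart
    from [n]: the compositions met along a composite have equal but not
    convertible weights, and their head sets all live in one type. *)
Definition head_set D k n (h : 'S_n) : {set 'I_D} :=
  [set j : 'I_D | (nact h^-1 j < k)%N].

Lemma head_set_imset k l (h : 'S_(k + l)) :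
  head_set (k + l) k h = h @: [set i : 'I_(k + l) | (i < k)%N].
Proof.
apply/setP => j; rewrite inE; apply/idP/imsetP => [jk|[x]].
  exists (h^-1 j)%g; last by rewrite permKV.
  by rewrite inE -nact_ord.
by rewrite inE => xk ->; rewrite -nact_ord nactK.
Qed.

Lemma card_head_set D k l (h : 'S_(k + l)) :
  (k + l)%N = D -> #|head_set D k h| = k.
Proof.
move=> e; case: D / e; rewrite head_set_imset card_imset ?card_lt_ord //.
exact: perm_inj.
Qed.

Lemma sumn_two_rows k l : sumn [:: k; l] = (k + l)%N.
Proof. by rewrite /= addn0. Qed.

(** With [head_set_onto], identifies the cosets of [S_k x S_l] with the subsets
    of size [k]. *)
Lemma mkcoset_two_rows_eq D k l (g h : 'S_(k + l)) : (k + l)%N = D ->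
  (mkcoset [:: k; l] g == mkcoset [:: k; l] h) =
  (head_set D k g == head_set D k h).
Proof.
move=> e; case: D / e.
have -> : (mkcoset [:: k; l] g == mkcoset [:: k; l] h) =
          ((g * h^-1)%g \in young (k + l) [:: k; l]).
  rewrite -val_eqE /=.
  rewrite -[young _ _]/(gval (Group (young_group_set (sumn_two_rows k l)))).
  by rewrite -mem_rcoset; apply/eqP/rcoset_eqP.
apply/(mem_youngP _ (sumn_two_rows k l))/eqP => [gh|/setP gh j i].
  apply/setP => x; rewrite !inE.
  have := gh 1%N (g^-1 x)%g; rewrite /= addn0 permM permKV.
  by rewrite -!nact_ord.
case: j => [|[|j]] //=; rewrite ?addn0.
  have := gh (g i); rewrite !inE -!nact_ord nactK => ->.
  by rewrite nactM.
by rewrite !ltn_ord.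
Qed.

Lemma head_set_onto k l (B : {set 'I_(k + l)}) : #|B| = k ->
  exists h : 'S_(k + l), head_set (k + l) k h = B.
Proof.
move=> cB; have cB' : #|~: B| = l.
  by apply/eqP; rewrite -(eqn_add2l k) -{1}cB cardsC card_ord.
pose f (i : 'I_(k + l)) := match split i with
  | inl j => enum_val (cast_ord (esym cB) j)
  | inr j => enum_val (cast_ord (esym cB') j) end.
have fB i : (f i \in B) = (i < k)%N.
  rewrite /f; case: (split_ordP i) => j _; first exact: enum_valP.
  apply/negbTE; rewrite -in_setC; exact: enum_valP.
have f_inj : injective f.
  move=> i j ij; have := fB i; rewrite ij fB; move: ij; rewrite /f.
  case: (split_ordP i) => i1 ->; case: (split_ordP j) => j1 -> /=.
  - by move/enum_val_inj/cast_ord_inj->.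
  - by [].
  - by [].
  by move/enum_val_inj/cast_ord_inj->.
exists (perm f_inj); apply/setP => x.
rewrite inE -[in RHS](permKV (perm f_inj) x).
by rewrite permE fB -nact_ord.
Qed.

Lemma card_young_two_rows k l : #|young (k + l) [:: k; l]| = (k`! * l`!)%N.
Proof.
have y1 m (s : 'S_m) : s \in young m [:: m].
  have mm : sumn [:: m] = m by rewrite /= addn0.
  by apply/mem_youngP => // -[|j] i; rewrite ?take0 //= addn0 !ltn_ord.
have -> : young (k + l) [:: k; l] = [set perm_sum p.1 p.2 | p in {: 'S_k * 'S_l}].
  apply/setP => g; apply/idP/imsetP => [gY|[[s t] _ ->]]; last first.
    by rewrite (@young_cat k l [:: k] [:: l]) ?y1 //= addn0.
  have [| |s [t [_ _ ->]]] := @young_cat_split k l [:: k] [:: l] g _ _ gY.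
  - by rewrite /= addn0.
  - by rewrite /= addn0.
  by exists (s, t).
rewrite card_imset ?card_prod ?card_Sn // => -[s t] [s' t'] /= /permP st.
congr pair; apply/permP => i.
  by have := st (lshift l i); rewrite !perm_sum_lshift => /lshift_inj.
by have := st (rshift k i); rewrite !perm_sum_rshift => /rshift_inj.
Qed.

(** The fibres of [head_set] are cosets; this is the count that the
    normalisation of [Delta] divides out. *)
Lemma card_head_set_fibre k l (B : {set 'I_(k + l)}) : #|B| = k ->
  #|[set g : 'S_(k + l) | head_set (k + l) k g == B]| = (k`! * l`!)%N.
Proof.
move=> /head_set_onto[h <-]; rewrite -card_young_two_rows.
have -> : [set g : 'S_(k + l) | head_set (k + l) k g == head_set (k + l) k h] =
          val (mkcoset [:: k; l] h).
  apply/setP => g; rewrite inE -mkcoset_two_rows_eq //.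
  rewrite -val_eqE /=.
  rewrite -[young _ _]/(gval (Group (young_group_set (sumn_two_rows k l)))).
  by apply/eqP/idP => [<-|/rcoset_eqP//]; rewrite rcoset_refl.
by rewrite /= card_rcoset.
Qed.

Lemma sum_ycoset_two_rows (V : nmodType) D k l (phi : {set 'I_D} -> V) :
  (k + l)%N = D ->
  \sum_(C : ycoset (k + l) [:: k; l]) phi (head_set D k (repr (val C))) =
  \sum_(B : {set 'I_D} | #|B| == k) phi B.
Proof.
move=> e; case: D / e phi => phi.
pose h' (B : {set 'I_(k + l)}) : ycoset (k + l) [:: k; l] :=
  mkcoset _ (odflt 1%g [pick h | head_set (k + l) k h == B]).
have repr_head_set (g : 'S_(k + l)) :
    head_set (k + l) k (repr (val (mkcoset [:: k; l] g))) = head_set (k + l) k g.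
  apply/eqP; rewrite -mkcoset_two_rows_eq //.
  by rewrite -repr_mkcoset // sumn_two_rows.
rewrite [RHS](reindex_onto (fun C => head_set (k + l) k (repr (val C))) h').
  apply: eq_bigl => C; rewrite card_head_set // eqxx /h'.
  case: pickP => [g|/(_ (repr (val C)))]; last by rewrite eqxx.
  by rewrite -mkcoset_two_rows_eq // -repr_mkcoset ?sumn_two_rows // => /eqP->.
move=> B /eqP cB.
rewrite repr_head_set /h'; case: pickP => [g /eqP //|nB].
by have [g /eqP] := head_set_onto cB; rewrite nB.
Qed.

(** * Alternating sums of binomial coefficients *)

Lemma alt_sum_bin (K : nzRingType) n N : (n <= N)%N ->
  \sum_(i < N.+1) (-1) ^+ i * ('C(n, i))%:R = (n == 0%N)%:R :> K.
Proof.
case: n => [_|n nN].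
  by rewrite big_ord_recl big1 ?addr0 ?mulr1 // => i _; rewrite bin0n mulr0.
(* Pascal's rule makes the partial sums telescope. *)
suff -> M : \sum_(i < M.+1) (-1) ^+ i * ('C(n.+1, i))%:R =
            (-1) ^+ M * ('C(n, M))%:R :> K.
  by rewrite bin_small ?mulr0.
elim: M => [|M IH]; first by rewrite big_ord_recl big_ord0 addr0 !bin0.
rewrite big_ord_recr /= IH binS natrD exprS mulN1r !mulNr mulrDr opprD.
by rewrite addrC addrNK.
Qed.

(** The index [b = a + l - k] is determined by [a], and exists as soon as
    [k - a <= l]; for the other [a] the binomial coefficient vanishes because
    [n <= l]. *)
Lemma alt_sum_bin_pairs (K : nzRingType) k l n : (n <= k)%N -> (n <= l)%N ->
  \sum_(a < k.+1) \sum_(b < l.+1 | (a + l == b + k)%N)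
    (-1) ^+ (k - a) * ('C(n, k - a))%:R = (n == 0%N)%:R :> K.
Proof.
move=> nk nl; rewrite -(alt_sum_bin K nk) [RHS](reindex_inj rev_ord_inj) /=.
apply: eq_bigr => a _; rewrite subSS.
have ak : (a <= k)%N by rewrite -ltnS.
have [le|lt] := leqP (k - a) l; last first.
  by rewrite bin_small ?mulr0 ?big1 // (leq_ltn_trans nl).
have bl : (a + l - k < l.+1)%N by lia.
rewrite (big_pred1 (Ordinal bl)) // => b /=; rewrite -val_eqE /=; lia.
Qed.

(** * Matrix coefficients indexed by subsets *)

Local Notation two_rows k l := (concat (row_comp k) (row_comp l)).

Section Matrix.
Variable F : fieldType.

(** [r] is any formula in two subsets, of which only the values on subsets of sizes
    [k] and [k'] matter ([has_matrix_eq]); composites become sums over subsets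
    ([has_matrix_cmp]). *)
Definition has_matrix D k l k' l' (f : perm_hom F (two_rows k l) (two_rows k' l'))
    (r : {set 'I_D} -> {set 'I_D} -> F) : Prop :=
  forall (h : 'S_(k + l)) (h' : 'S_(k' + l')),
    f (cvec F (X := two_rows k l) h) (mkcoset [:: k'; l'] h') =
    r (head_set D k h) (head_set D k' h').

Lemma cvec_coef D k l (h h' : 'S_(k + l)) : (k + l)%N = D ->
  cvec F (X := two_rows k l) h (mkcoset [:: k; l] h') =
  (head_set D k h' == head_set D k h)%:R.
Proof.
move=> e; rewrite (@bvecE F (ycoset (k + l) [:: k; l])).
by rewrite (mkcoset_two_rows_eq _ _ e).
Qed.

Lemma has_matrix_eq D k l k' l' (f g : perm_hom F (two_rows k l) (two_rows k' l'))
    (r s : {set 'I_D} -> {set 'I_D} -> F) :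
  (k + l)%N = D -> (k' + l')%N = D -> has_matrix f r -> has_matrix g s ->
  (forall A B : {set 'I_D}, #|A| = k -> #|B| = k' -> r A B = s A B) -> f = g.
Proof.
move=> e e' fr gs rs; apply: eq_cvec => h; apply/ffunP => C.
rewrite (repr_mkcoset C (sumn_parts (two_rows k' l'))).
by rewrite [LHS]fr [RHS]gs rs ?card_head_set.
Qed.

Lemma has_matrix_cmp D k l k1 l1 k' l'
    (g : perm_hom F (two_rows k1 l1) (two_rows k' l'))
    (f : perm_hom F (two_rows k l) (two_rows k1 l1))
    (r s : {set 'I_D} -> {set 'I_D} -> F) :
  (k1 + l1)%N = D -> has_matrix f r -> has_matrix g s ->
  has_matrix (perm_cmp g f)
    (fun A B => \sum_(C : {set 'I_D} | #|C| == k1) r A C * s C B).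
Proof.
move=> e fr gs h h'.
rewrite perm_cmpE (@lfun_bvec F (ycoset (k1 + l1) [:: k1; l1])).
rewrite sum_ffunE -(sum_ycoset_two_rows (fun C => r _ C * s C _) e).
apply: eq_bigr => C _; rewrite ffunE.
have CE := repr_mkcoset C (sumn_two_rows k1 l1).
by rewrite {1 2}CE [X in X *: _]fr [X in _ *: X]gs.
Qed.

Lemma has_matrix_sum D k l k' l' (I : finType) (P : pred I)
    (f : I -> perm_hom F (two_rows k l) (two_rows k' l'))
    (r : I -> {set 'I_D} -> {set 'I_D} -> F) :
  (forall i, P i -> has_matrix (f i) (r i)) ->
  has_matrix (\sum_(i | P i) f i) (fun A B => \sum_(i | P i) r i A B).
Proof.
move=> fr h h'.
rewrite (big_morph (@perm_hom_val F _ _) (op1 := +%R) (id1 := 0)) //.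
rewrite sum_lfunE sum_ffunE.
by apply: eq_bigr => i /fr.
Qed.

Lemma has_matrix_scale D k l k' l'
    (f : perm_hom F (two_rows k l) (two_rows k' l')) a
    (r : {set 'I_D} -> {set 'I_D} -> F) :
  has_matrix f r -> has_matrix (a *: f) (fun A B => a * r A B).
Proof. by move=> fr h h'; rewrite scale_lfunE ffunE fr. Qed.

Lemma relabelE (X Y : PermCat F) (e : X = Y) : relabel X Y = perm_cast F e.
Proof. by rewrite /relabel; case: eqP => [e'|//]; apply: cast_irr. Qed.

Lemma has_matrix_relabel D k l k1 l1 k' l'
    (f : perm_hom F (two_rows k l) (two_rows k1 l1))
    (r : {set 'I_D} -> {set 'I_D} -> F) : k1 = k' -> l1 = l' ->
  has_matrix f r ->
  has_matrix (perm_cmp (@relabel F (two_rows k1 l1) (two_rows k' l')) f) r.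
Proof.
move=> ek el; case: k' / ek; case: l' / el => fr h h'.
by rewrite perm_cmpE (relabelE erefl) perm_idE fr.
Qed.

Lemma has_matrix_braid D k l : (k + l)%N = D ->
  has_matrix (braid F (row_comp k) (row_comp l))
    (fun A B : {set 'I_D} => (B == ~: A)%:R).
Proof.
move=> e; case: D / e => h h'.
rewrite braid_cvec (cvec_coef (D := k + l)) 1?addnC //; congr (_ == _)%:R.
set p := (X in head_set _ _ X); apply/setP => j; rewrite !inE -leqNgt.
have pE x : nact p x = nact h (nact (block_swap k l) x).
  by rewrite nactM nact_cast.
set y := nact h^-1 j; have jE : nact h y = j by rewrite nactKV.
have ylt : (y < k + l)%N by rewrite nact_lt.
set x := nact p^-1 j; have yE : y = nact (block_swap k l) x.
  by rewrite -(nactK h (nact _ _)) -pE nactKV.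
have xlt : (x < l + k)%N by rewrite nact_lt (leq_trans (ltn_ord j)) // addnC.
by rewrite yE nact_swap; do 2 case: ltnP => ?; lia.
Qed.
End Matrix.

(** * The coefficients of the ladder operators *)

Section Ladder.
Variable F : fieldType.
Hypothesis pcharF0 : [pchar F] =i pred0.

Lemma Delta_cvec m n (h : 'S_(m + n)) :
  Delta F m n (cvec F (X := row_comp (m + n)) h) =
  \sum_(g : 'S_(m + n)) (m`! * n`!)%:R^-1 *: cvec F (X := two_rows m n) g.
Proof. by rewrite [LHS](@linext_bvec F) scaler_sumr. Qed.

Lemma nabla_cvec m n (h : 'S_(m + n)) :
  nabla F m n (cvec F (X := two_rows m n) h) = cvec F (X := row_comp (m + n)) h.
Proof.
rewrite [LHS](@linext_bvec F); congr bvec; exact: coset_row.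
Qed.

Lemma acts_by_nabla m n :
  acts_by (nabla F m n : perm_hom F (two_rows m n) (row_comp (m + n))) 1%g.
Proof. by exists erefl => h; rewrite cast_perm_id mul1g nabla_cvec. Qed.

Lemma acts_by_id X : acts_by (perm_id F X) 1%g.
Proof. exact: (acts_by_cast F (erefl X)). Qed.

Lemma Delta_tensl m n X (h : 'S_(m + n + wt X)) :
  perm_tens (Delta F m n) (perm_id F X)
    (cvec F (X := concat (row_comp (m + n)) X) h) =
  \sum_(g : 'S_(m + n)) (m`! * n`!)%:R^-1 *:
     cvec F (X := concat (two_rows m n) X) (perm_sum g 1 * h)%g.
Proof.
have e : wt (concat (row_comp (m + n)) X) = wt (concat (two_rows m n) X) by [].
rewrite cvec_outer (tensE _ _ e) cast_perm_id Delta_cvec perm_idE.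
rewrite outer_suml linear_sum.
apply: eq_bigr => g _; rewrite linearZ /= outer_cvec.
by rewrite (@permact_cvec F (concat (two_rows m n) X)).
Qed.

Lemma Delta_tensr m n X (h : 'S_(wt X + (m + n))) :
  perm_tens (perm_id F X) (Delta F m n)
    (cvec F (X := concat X (row_comp (m + n))) h) =
  \sum_(g : 'S_(m + n)) (m`! * n`!)%:R^-1 *:
     cvec F (X := concat X (two_rows m n)) (perm_sum 1 g * h)%g.
Proof.
have e : wt (concat X (row_comp (m + n))) = wt (concat X (two_rows m n)) by [].
rewrite cvec_outer (tensE _ _ e) cast_perm_id Delta_cvec perm_idE.
rewrite outer_sumr linear_sum.
apply: eq_bigr => g _; rewrite linearZ /= outer_cvec.
by rewrite (@permact_cvec F (concat X (two_rows m n))).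
Qed.

Lemma sum_head_set_fibre m n (P : {set 'I_(m + n)}) : #|P| = m ->
  \sum_(g : 'S_(m + n))
    (m`! * n`!)%:R^-1 * (head_set (m + n) m g == P)%:R = 1 :> F.
Proof.
move=> cP; rewrite -mulr_sumr.
have -> : \sum_(g : 'S_(m + n)) (head_set (m + n) m g == P)%:R =
          (m`! * n`!)%:R :> F.
  rewrite -(card_head_set_fibre cP) -sum1dep_card natr_sum [RHS]big_mkcond /=.
  by apply: eq_bigr => g _; case: eqP.
by rewrite mulVf // ((pcharf0P F).1 pcharF0) -lt0n muln_gt0 !fact_gt0.
Qed.

Lemma mem_head_set D k n (p : 'S_n) (j : 'I_D) x :
  nact p x = j -> (j \in head_set D k p) = (x < k)%N.
Proof. by move=> jE; rewrite inE -jE nactK. Qed.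

Section Split.
Variables (m n k : nat).

Section Left.
Variables (h : 'S_(m + n + k)) (B : {set 'I_(m + n + k)}).
Let P := [set i : 'I_(m + n) | h (lshift k i) \in B].

(** Permuting the first [m + n] points before applying [h] produces the [m]-subsets
    of the head set of [h] under [m + n], each once per coset of [S_m x S_n]. *)
Lemma head_set_suml p (g : 'S_(m + n)) (q : 'S_p) :
  nact q =1 nact (perm_sum g (1%g : 'S_k) * h) ->
  (B == head_set (m + n + k) m q) =
  (B \subset head_set (m + n + k) (m + n) h) && (head_set (m + n) m g == P).
Proof.
move=> qE; have {}qE x : nact q x = nact h (nact (perm_sum g (1%g : 'S_k)) x).
  by rewrite qE nactM.
have mem_q (i : 'I_(m + n)) :
    (h (lshift k i) \in head_set (m + n + k) m q) = (i \in head_set (m + n) m g).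
  rewrite [RHS]inE; apply: mem_head_set.
  by rewrite qE nact_sum nact_lt ltn_ord nactKV nact_lshift.
apply/eqP/andP => [BE|[Bh /eqP/setP gP]]; [split|].
- apply/subsetP => j; rewrite BE !inE => jm.
  have := nactKV q j; rewrite qE => <-; rewrite nactK nact_sum.
  have lt := leq_trans jm (leq_addr n m).
  by rewrite lt nact_lt.
- by apply/eqP/setP => i; rewrite !inE BE mem_q inE.
apply/setP => j; have [y ->] : exists y, j = h y.
  by exists (h^-1 j)%g; rewrite permKV.
have [i ->|i ->] := split_ordP y.
  by have := gP i; rewrite [RHS]inE mem_q.
have /negPf-> : h (rshift (m + n) i) \notin B.
  apply/negP => /(subsetP Bh).
  by rewrite (mem_head_set _ (nact_rshift h i)) ltnNge leq_addr.
have qi : nact q (m + n + i)%N = h (rshift (m + n) i).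
  by rewrite qE nact_sum ltnNge leq_addr /= nact1 subnKC ?leq_addr ?nact_rshift.
by rewrite (mem_head_set _ qi); lia.
Qed.

Lemma card_preim_suml : B \subset head_set (m + n + k) (m + n) h -> #|P| = #|B|.
Proof.
move=> Bh; have f_inj : injective (fun i => h (lshift k i)).
  by move=> i j /perm_inj/lshift_inj.
rewrite -(card_imset _ f_inj); apply: eq_card => j.
apply/imsetP/idP => [[i + ->]|jB].
  by rewrite inE.
have := subsetP Bh _ jB; rewrite inE => lt.
have iE : h (lshift k (Ordinal lt)) = j.
  by rewrite -[RHS](permKV h); congr (h _); apply: val_inj; rewrite /= nact_ord.
by exists (Ordinal lt); rewrite ?inE iE.
Qed.
End Left.

Section Right.
Variables (h : 'S_(k + (m + n))) (B : {set 'I_(k + (m + n))}).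
Let P := [set i : 'I_(m + n) | h (rshift k i) \in B].

(** Permuting the last [m + n] points adds to the head set of [h] an [m]-subset of
    its complement. *)
Lemma head_set_sumr p (g : 'S_(m + n)) (q : 'S_p) :
  nact q =1 nact (perm_sum (1%g : 'S_k) g * h) ->
  (B == head_set (k + (m + n)) (k + m) q) =
  (head_set (k + (m + n)) k h \subset B) && (head_set (m + n) m g == P).
Proof.
move=> qE; have {}qE x : nact q x = nact h (nact (perm_sum (1%g : 'S_k) g) x).
  by rewrite qE nactM.
have mem_q (i : 'I_(m + n)) :
    (h (rshift k i) \in head_set (k + (m + n)) (k + m) q) =
    (i \in head_set (m + n) m g).
  rewrite [RHS]inE -(ltn_add2l k); apply: mem_head_set.
  by rewrite qE nact_sum ltnNge leq_addr /= addKn nactKV nact_rshift.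
have mem_ql (i : 'I_k) :
    h (lshift (m + n) i) \in head_set (k + (m + n)) (k + m) q.
  have qi : nact q i = h (lshift (m + n) i).
    by rewrite qE nact_sum ltn_ord nact1 nact_lshift.
  by rewrite (mem_head_set _ qi) (leq_trans (ltn_ord i)) ?leq_addr.
have mem_hr (i : 'I_(m + n)) : h (rshift k i) \notin head_set (k + (m + n)) k h.
  by rewrite (mem_head_set _ (nact_rshift h i)) ltnNge leq_addr.
have hP j : exists y, j = h y by exists (h^-1 j)%g; rewrite permKV.
apply/eqP/andP => [BE|[hB /eqP/setP gP]]; [split|].
- apply/subsetP => j; have [y ->] := hP j; rewrite BE.
  by case: (split_ordP y) => i ->; rewrite ?mem_ql // => /(negP (mem_hr i)).
- by apply/eqP/setP => i; rewrite [RHS]inE BE mem_q.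
apply/setP => j; have [y ->] := hP j; have [i ->|i ->] := split_ordP y.
  by rewrite mem_ql (subsetP hB) // (mem_head_set _ (nact_lshift h i)).
by rewrite mem_q gP inE.
Qed.

Lemma card_preim_sumr :
  head_set (k + (m + n)) k h \subset B -> (k + #|P|)%N = #|B|.
Proof.
move=> hB; have f_inj : injective (fun i => h (rshift k i)).
  by move=> i j /perm_inj/rshift_inj.
rewrite -(cardsID (head_set (k + (m + n)) k h) B) (setIidPr hB) card_head_set //.
congr addn; rewrite -(card_imset _ f_inj); apply: eq_card => j.
apply/imsetP/setDP => [[i + ->]|[jB]].
  rewrite inE => ->; split=> //.
  by rewrite (mem_head_set _ (nact_rshift h i)) ltnNge leq_addr.
have [y jE] : exists y, j = h y by exists (h^-1 j)%g; rewrite permKV.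
have [i yE|i yE] := split_ordP y; last by exists i; rewrite ?inE -?yE -?jE.
by rewrite jE yE (mem_head_set _ (nact_lshift h i)) ltn_ord.
Qed.
End Right.
End Split.

Lemma hom_sumE X Y (f : perm_hom F X Y) (I : finType) (a : I -> F) w C :
  f (\sum_i a i *: w i) C = \sum_i a i * f (w i) C.
Proof.
by rewrite linear_sum sum_ffunE; apply: eq_bigr => i _; rewrite linearZ ffunE.
Qed.

(** [F^(a)] is stated with [m] for [k - a] and with the intermediate sizes
    constrained only by equations, so that they can be substituted. The sum over
    ['S_(m + a)] coming from [Delta] hits every [m]-subset of [A] equally often,
    and its normalisation makes this exactly once. *)
Lemma has_matrix_Fpow D m a l k l' :
  k = (m + a)%N -> (a + l)%N = l' -> (k + l)%N = D ->
  has_matrix (D := D) (k := k) (l := l) (k' := m) (l' := l')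
    ((idmor (Mrow F m) ⊠ (relabel (Mrow F (a + l)) (Mrow F l') ⋅ nabla F a l))
     ⋅ assoc (Mrow F m) (Mrow F a) (Mrow F l)
     ⋅ ((Delta F m a ⋅ relabel (Mrow F k) (Mrow F (m + a)))
        ⊠ idmor (Mrow F l)))
    (fun A B => (B \subset A)%:R).
Proof.
move=> ek el eD; case: D / eD; case: l' / el; rewrite {}ek => {k} h h'.
rewrite !(relabelE (erefl _)) !(cmp_idl (perm_category F)).
rewrite !(cmp_idr (perm_category F)).
have [r [[e rP] rE]] := acts_by_cmp
  (acts_by_tens (acts_by_id (row_comp m)) (acts_by_nabla a l))
  (acts_by_cast F (concatA (row_comp m) (row_comp a) (row_comp l))).
rewrite perm_cmpE Delta_tensl hom_sumE.
set A := head_set _ _ h; set B := head_set _ _ h'.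
pose P := [set i : 'I_(m + a) | h (lshift l i) \in B].
have cB : #|B| = m by rewrite card_head_set // addnA.
transitivity (\sum_(g : 'S_(m + a)) (m`! * a`!)%:R^-1 *
    ((B \subset A) && (head_set (m + a) m g == P))%:R : F).
  apply: eq_bigr => g _; rewrite rP; congr (_ * _).
  rewrite (@cvec_coef F (m + a + l)) ?addnA //.
  congr (_%:R); congr nat_of_bool.
  apply: head_set_suml => x.
  by rewrite [LHS]nactM nact_cast rE /= perm_sum1 !nact1.
have [BA|nBA] := boolP (B \subset A); last first.
  by rewrite big1 // => g _; rewrite mulr0.
by rewrite sum_head_set_fibre // card_preim_suml.
Qed.

Lemma has_matrix_Epow D k b l' l : l = (b + l')%N -> (k + l)%N = D ->
  has_matrix (D := D) (k := k) (l := l) (k' := k + b) (l' := l')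
    ((nabla F k b ⊠ idmor (Mrow F l'))
     ⋅ assocV (Mrow F k) (Mrow F b) (Mrow F l')
     ⋅ (idmor (Mrow F k) ⊠
        (Delta F b l' ⋅ relabel (Mrow F l) (Mrow F (b + l')))))
    (fun A B => (A \subset B)%:R).
Proof.
move=> el eD; case: D / eD; rewrite {}el => {l} h h'.
rewrite (relabelE (erefl _)) (cmp_idr (perm_category F)).
have [r [[e rP] rE]] := acts_by_cmp
  (acts_by_tens (acts_by_nabla k b) (acts_by_id (row_comp l')))
  (acts_by_cast F (esym (concatA (row_comp k) (row_comp b) (row_comp l')))).
rewrite perm_cmpE Delta_tensr hom_sumE.
set A := head_set _ _ h; set B := head_set _ _ h'.
pose P := [set i : 'I_(b + l') | h (rshift k i) \in B].
have cB : #|B| = (k + b)%N by rewrite card_head_set // addnA.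
transitivity (\sum_(g : 'S_(b + l')) (b`! * l'`!)%:R^-1 *
    ((A \subset B) && (head_set (b + l') b g == P))%:R : F).
  apply: eq_bigr => g _; rewrite rP; congr (_ * _).
  rewrite (@cvec_coef F (k + (b + l'))) ?addnA //.
  congr (_%:R); congr nat_of_bool.
  apply: head_set_sumr => x.
  by rewrite [LHS]nactM nact_cast rE /= perm_sum1 !nact1.
have [AB|nAB] := boolP (A \subset B); last first.
  by rewrite big1 // => g _; rewrite mulr0.
rewrite sum_head_set_fibre //; apply/eqP; rewrite -(eqn_add2l k) -cB; apply/eqP.
exact: card_preim_sumr.
Qed.
End Ladder.

(** * The braiding on one-row modules *)

Section Formula.
Variable F : fieldType.
Hypothesis pcharF0 : [pchar F] =i pred0.

Lemma sum_common_subsets D i (A B : {set 'I_D}) :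
  \sum_(C : {set 'I_D} | #|C| == i) (C \subset A)%:R * (C \subset B)%:R =
  'C(#|A :&: B|, i)%:R :> F.
Proof.
rewrite -cards_draws -sum1dep_card natr_sum big_mkcond [RHS]big_mkcond.
apply: eq_bigr => C _; rewrite subsetI andbC.
by case: (_ == i); rewrite //= -natrM mulnb; case: andP.
Qed.

Lemma sum_common_supersets D i (A B : {set 'I_D}) : (i <= D)%N ->
  \sum_(C : {set 'I_D} | #|C| == i) (A \subset C)%:R * (B \subset C)%:R =
  'C(#|~: A :&: ~: B|, D - i)%:R :> F.
Proof.
move=> iD; rewrite -sum_common_subsets (reindex_inj (inv_inj (@setCK _))).
apply: eq_big => [C|C _]; last by rewrite ![_ \subset ~: C]subsetC.
by have := cardsC C; rewrite card_ord => cC; apply/eqP/eqP; lia.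
Qed.

(** Turns the condition under which an alternating binomial sum is nonzero into
    the coefficient of the braiding. *)
Lemma cap_empty_compl D k l (A B : {set 'I_D}) : (k + l)%N = D ->
  #|A| = k -> #|B| = l -> (#|A :&: B| == 0%N) = (B == ~: A).
Proof.
move=> e cA cB; have cA' : #|~: A| = l.
  by apply/eqP; rewrite -(eqn_add2l k) -{1}cA cardsC card_ord e.
rewrite cards_eq0 setI_eq0 disjoint_sym disjoints_subset.
by rewrite eqEcard cA' cB leqnn andbT.
Qed.

Lemma braid_EF k l : braid F (row_comp k) (row_comp l) =
  \sum_(a < k.+1) \sum_(b < l.+1 | (a + l == b + k)%N)
    (-1) ^+ (k - a) *:
      (relabel (Mrow F (k - a + b) ⊗ Mrow F (l + a - b)) (Mrow F l ⊗ Mrow F k)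
       ⋅ (Epow F b (k - a) (l + a) ⋅ Fpow F a k l)).
Proof.
apply: (has_matrix_eq (erefl (k + l)%N) (addnC l k)) => [||A B cA cB].
- exact: has_matrix_braid.
- apply: has_matrix_sum => a _; apply: has_matrix_sum => b /eqP ab.
  have ak : (a <= k)%N by rewrite -ltnS.
  apply/has_matrix_scale/has_matrix_relabel; [lia|lia|].
  rewrite /Epow /Fpow ak (_ : (b <= l + a)%N); last lia.
  apply: has_matrix_cmp; first lia.
    by apply: (has_matrix_Fpow pcharF0); lia.
  by apply: (has_matrix_Epow pcharF0); lia.
cbv beta; rewrite -(cap_empty_compl (erefl _) cA cB) -(@alt_sum_bin_pairs F k l).
- apply: eq_bigr => a _; apply: eq_bigr => b _.
  by rewrite sum_common_subsets.
- by rewrite (leq_trans (subset_leq_card (subsetIl A B))) ?cA.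
by rewrite (leq_trans (subset_leq_card (subsetIr A B))) ?cB.
Qed.

Lemma braid_FE k l : braid F (row_comp k) (row_comp l) =
  \sum_(a < l.+1) \sum_(b < k.+1 | (a + k == b + l)%N)
    (-1) ^+ (l - a) *:
      (relabel (Mrow F (k + a - b) ⊗ Mrow F (l - a + b)) (Mrow F l ⊗ Mrow F k)
       ⋅ (Fpow F b (k + a) (l - a) ⋅ Epow F a k l)).
Proof.
apply: (has_matrix_eq (erefl (k + l)%N) (addnC l k)) => [||A B cA cB].
- exact: has_matrix_braid.
- apply: has_matrix_sum => a _; apply: has_matrix_sum => b /eqP ab.
  have al : (a <= l)%N by rewrite -ltnS.
  apply/has_matrix_scale/has_matrix_relabel; [lia|lia|].
  rewrite /Epow /Fpow al (_ : (b <= k + a)%N); last lia.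
  apply: has_matrix_cmp; first lia.
    by apply: (has_matrix_Epow pcharF0); lia.
  by apply: (has_matrix_Fpow pcharF0); lia.
(* [#|A| + #|B|] is the size of the ambient set. *)
have cAB : #|~: A :&: ~: B| = #|A :&: B|.
  rewrite -setCU; have := cardsC (A :|: B); have := cardsUI A B.
  by rewrite card_ord cA cB; lia.
cbv beta; rewrite -(cap_empty_compl (erefl _) cA cB) -(@alt_sum_bin_pairs F l k).
- apply: eq_bigr => a _; apply: eq_bigr => b _.
  have al : (a <= l)%N by rewrite -ltnS.
  by rewrite sum_common_supersets ?cAB ?leq_add2l // subnDl.
- by rewrite (leq_trans (subset_leq_card (subsetIr A B))) ?cB.
by rewrite (leq_trans (subset_leq_card (subsetIl A B))) ?cA.
Qed.
End Formula.

Theorem theorem5p0p1 (R : realType) :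
  is_monoidal (PermCat R[i]) /\
  exists beta : forall X Y : PermCat R[i], mor (X ⊗ Y) (Y ⊗ X),
    is_symmetric_braiding beta /\
    forall k l : nat,
      beta (Mrow R[i] k) (Mrow R[i] l) =
        \sum_(a < k.+1) \sum_(b < l.+1 | (a + l == b + k)%N)
          (-1) ^+ (k - a) *:
            (relabel (Mrow R[i] (k - a + b) ⊗ Mrow R[i] (l + a - b))
                     (Mrow R[i] l ⊗ Mrow R[i] k)
             ⋅ (Epow R[i] b (k - a) (l + a) ⋅ Fpow R[i] a k l)) /\
      beta (Mrow R[i] k) (Mrow R[i] l) =
        \sum_(a < l.+1) \sum_(b < k.+1 | (a + k == b + l)%N)
          (-1) ^+ (l - a) *:
            (relabel (Mrow R[i] (k + a - b) ⊗ Mrow R[i] (l - a + b))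
                     (Mrow R[i] l ⊗ Mrow R[i] k)
             ⋅ (Fpow R[i] b (k + a) (l - a) ⋅ Epow R[i] a k l)).
Proof.
have pchar0 : [pchar R[i]] =i pred0 by exact: Num.Theory.pchar_num.
split; first exact: perm_monoidal.
exists (braid R[i]); split; first exact: perm_braiding.
by move=> k l; split; [exact: braid_EF|exact: braid_FE].
Qed.
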